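(* Let $\lambda\vDash n$ be a composition of $n$ and $\alpha\vdash n$ a partition of $n$. Then $$\pi_\lambda(b_\alpha)=\frac{|S_n|}{|S_\lambda|\cdot|C_\alpha|_{S_n}}\sum_{\theta\in\Lambda_\lambda(\alpha)}|C_\theta|_{S_\lambda}\,\mathcal N_{S_\lambda,S_\theta}(\eta_\theta).$$
   Context: $S_n$ is the symmetric group with simple reflections $s_i=(i\ \ i+1)$, $1\le i\le n-1$, and length function $\ell$. The Iwahori--Hecke algebra $\mathcal H=\mathcal H_n$ is the associative $\mathbb Z[\xi]$-algebra ($\xi$ an indeterminate) with identity $\tilde T_1$, generated by $\tilde T_{s_1},\dots,\tilde T_{s_{n-1}}$ subject to the braid relations $\tilde T_{s_i}\tilde T_{s_j}=\tilde T_{s_j}\tilde T_{s_i}$ for $|i-j|\ge 2$, $\tilde T_{s_i}\tilde T_{s_{i+1}}\tilde T_{s_i}=\tilde T_{s_{i+1}}\tilde T_{s_i}\tilde T_{s_{i+1}}$, and $\tilde T_{s_i}^2=\tilde T_1+\xi\tilde T_{s_i}$. For a reduced expression $w=s_{i_1}\cdots s_{i_r}$ put $\tilde T_w=\tilde T_{s_{i_1}}\cdots\tilde T_{s_{i_r}}$; the $\tilde T_w$, $w\in S_n$, form a $\mathbb Z[\xi]$-basis. A composition $\lambda=(\lambda_1,\dots,\lambda_r)$ of $n$ ($\lambda\vDash n$) is a finite sequence of positive integers with sum $n$; it is a partition ($\lambda\vdash n$) if weakly decreasing. $S_\lambda=S_{\lambda_1}\times\cdots\times S_{\lambda_r}\le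 S_n$ is the standard parabolic subgroup, with $i$-th factor generated by $s_{\lambda_1+\dots+\lambda_{i-1}+1},\dots,s_{\lambda_1+\dots+\lambda_i-1}$ (trivial if $\lambda_i=1$). $\mathcal H_\lambda$ is the subalgebra of $\mathcal H_n$ generated by the $\tilde T_s$ with $s$ a simple reflection in $S_\lambda$. $\lambda-1$ denotes the composition obtained from $\lambda$ by replacing each $\lambda_i>1$ by the two consecutive entries $\lambda_i-1,1$. The element $w_\lambda\in S_\lambda$ is the product over $i=1,\dots,r$ of $s_{\lambda_1+\dots+\lambda_{i-1}+1}\cdots s_{\lambda_1+\dots+\lambda_i-1}$ (in increasing order of indices; empty product if $\lambda_i=1$). For standard parabolic subgroups $S_\mu\le S_\lambda$ and $h\in\mathcal H$, the relative norm is $\mathcal N_{S_\lambda,S_\mu}(h)=\sum_{d}\tilde T_{d^{-1}}h\tilde T_d$, the sum over the distinguished (minimal length) representatives $d$ of the right cosets $S_\mu d$ of $S_\mu$ in $S_\lambda$. Put $\eta_\lambda=\mathcal N_{S_{\lambda-1},1}(\tilde T_{w_\lambda})$ for $\lambda\vDash n$ and $b_\alpha=\mathcal N_{S_n,S_\alpha}(\eta_\alpha)$. The projection $\pi_\lambda:\mathcal H_n\to\mathcal H_\lambda$ is the $\mathbb Z[\xi]$-linear map with $\pi_\lambda(\tilde T_w)=\tilde T_w$ if $w\in S_\lambda$ and $\pi_\lambda(\tilde T_w)=0$ otherwise. A $\lambda$-multipartition of $n$, for $\lambda=(\lambda_1,\dots,\lambda_r)$, is a tuple $\theta=(\theta_1,\dots,\theta_r)$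 of partitions with $\theta_i\vdash\lambda_i$. $\Lambda_\lambda(\alpha)$ is the set of $\lambda$-multipartitions $\theta$ of $n$ such that the multiset of all components of $\theta_1,\dots,\theta_r$ equals the multiset of components of $\alpha$ (an empty sum, when $\Lambda_\lambda(\alpha)=\emptyset$, is $0$). The derived composition of $\theta$ is the composition of $n$ obtained by concatenating $\theta_1,\dots,\theta_r$; $S_\theta$, $\eta_\theta$ mean $S_\mu$, $\eta_\mu$ for $\mu$ the derived composition of $\theta$ (so $S_\theta\le S_\lambda$). $C_\theta$ is the conjugacy class of $S_\lambda$ consisting of elements whose component in the factor $S_{\lambda_i}$ has cycle type $\theta_i$ for each $i$, and $|C_\theta|_{S_\lambda}$ is its size. $C_\alpha$ is the conjugacy class of $S_n$ of cycle type $\alpha$ and $|C_\alpha|_{S_n}$ is its size. *)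

(* Defs.v *)
From HB Require Import structures.
From mathcomp Require Import all_boot all_order all_algebra all_fingroup.
From mathcomp Require Import zify.

Set Implicit Arguments.
Unset Strict Implicit.
Unset Printing Implicit Defensive.

Import GRing.Theory.
Local Open Scope ring_scope.

(* Points are numbered from 0: [sref i] with i : 'I_n.-1 swaps i and i+1, so
   it is the reflection usually written s_{i+1}.  As everywhere in MathComp,
   (s * t)%g is "s, then t"; the Hecke algebra only sees S_n as a Coxeter
   group, for which this choice is immaterial.                               *)
Local Ltac split_ifs := repeat match goal with
  | |- context [if ?b then _ else _] =>
    lazymatch b with
    | context [if _ then _ else _] => fail
    | _ => destruct b eqn:?
    end
  end.

Section SymmetricGroup.

Variable n : nat.
Implicit Types (i j : 'I_n.-1) (w : 'S_n) (u : seq 'I_n.-1).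

Lemma ord_hi_subproof i : (i.+1 < n)%N.
Proof. by case: n i => [|m] i; [case: i | rewrite ltnS; case: i]. Qed.

Definition ord_lo i : 'I_n := Ordinal (ltnW (ord_hi_subproof i)).
Definition ord_hi i : 'I_n := Ordinal (ord_hi_subproof i).

Definition sref i : 'S_n := tperm (ord_lo i) (ord_hi i).

Definition wprod u : 'S_n := (\prod_(i <- u) sref i)%g.

Lemma wprod_nil : wprod [::] = 1%g. Proof. exact: big_nil. Qed.
Lemma wprod_cons i u : wprod (i :: u) = (sref i * wprod u)%g.
Proof. exact: big_cons. Qed.

Definition inversions w :=
  [set p : 'I_n * 'I_n | (p.1 < p.2)%N && (w p.2 < w p.1)%N].
Definition ninv w := #|inversions w|.

Lemma sref_lo i : sref i (ord_lo i) = ord_hi i. Proof. exact: tpermL. Qed.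
Lemma sref_hi i : sref i (ord_hi i) = ord_lo i. Proof. exact: tpermR. Qed.
Lemma srefK i : (sref i * sref i = 1)%g. Proof. exact: tperm2. Qed.
Lemma srefV i : (sref i)^-1%g = sref i. Proof. exact: tpermV. Qed.
Lemma srefKl i w : (sref i * (sref i * w) = w)%g.
Proof. by rewrite mulgA srefK mul1g. Qed.
Lemma srefKr i w : (w * sref i * sref i = w)%g.
Proof. by rewrite -mulgA srefK mulg1. Qed.
Lemma srefKp i x : sref i (sref i x) = x. Proof. exact: tpermK. Qed.

Lemma lo_neq_hi i : ord_lo i != ord_hi i.
Proof. by rewrite -val_eqE /= neq_ltn leqnn. Qed.

Lemma srefP i (x : 'I_n) : sref i x =
  (if x == i :> nat then i.+1
   else if x == i.+1 :> nat then i : nat else x : nat) :> nat.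
Proof.
rewrite /sref; case: tpermP => [->|->|/eqP + /eqP]; rewrite ?eqxx //=.
  by rewrite -[_ == _]/(i.+1 == i)%N eq_sym ltn_eqF.
by rewrite -!val_eqE /= => /negbTE-> /negbTE->.
Qed.

Lemma sref_mono i (x y : 'I_n) : (x, y) != (ord_lo i, ord_hi i) ->
  (x, y) != (ord_hi i, ord_lo i) -> (sref i x < sref i y)%N = (x < y)%N.
Proof.
rewrite !xpair_eqE -!val_eqE /= !srefP.
move: (nat_of_ord x) (nat_of_ord y) (nat_of_ord i) => a b c.
by split_ifs; lia.
Qed.

Lemma ninv_asc i w : (w (ord_lo i) < w (ord_hi i))%N ->
  ninv (sref i * w)%g = (ninv w).+1.
Proof.
move=> asc; pose f (p : 'I_n * 'I_n) := (sref i p.1, sref i p.2).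
have fK : cancel f f by case=> x y; rewrite /f /= !srefKp.
rewrite /ninv -(card_imset (mem (inversions w)) (can_inj fK)) -add1n.
rewrite (_ : inversions _ = (ord_lo i, ord_hi i) |: f @: inversions w).
  rewrite cardsU1 (can_imset_pre _ fK) !inE /= sref_lo sref_hi.
  by rewrite [(_.+1 < _)%N]ltnNge leqW.
rewrite (can_imset_pre _ fK); apply/setP=> -[x y]; rewrite !inE /= !permM.
have [[-> ->]|nlh] := altP ((x, y) =P (ord_lo i, ord_hi i)).
  by rewrite sref_lo sref_hi ltnSn asc.
have [[-> ->]|nhl] := altP ((x, y) =P (ord_hi i, ord_lo i)).
  by rewrite sref_lo sref_hi !(ltnNge (w _)) (ltnW asc) !andbF.
by rewrite sref_mono.
Qed.

Lemma perm_lt_neq w (x y : 'I_n) : x != y ->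
  (w x < w y)%N = ~~ (w y < w x)%N.
Proof.
move=> nxy; rewrite -leqNgt ltn_neqAle val_eqE (inj_eq perm_inj).
by rewrite nxy.
Qed.

Lemma ninv_desc i w : (w (ord_hi i) < w (ord_lo i))%N ->
  ninv w = (ninv (sref i * w)%g).+1.
Proof.
by move=> desc; rewrite -(@ninv_asc i) ?srefKl // !permM sref_lo sref_hi.
Qed.

Lemma ninvV w : ninv w^-1%g = ninv w.
Proof.
pose f (p : 'I_n * 'I_n) := (w p.2, w p.1).
pose g (p : 'I_n * 'I_n) := (w^-1%g p.2, w^-1%g p.1).
have fK : cancel f g by case=> x y; rewrite /f /g /= !permK.
rewrite /ninv -(card_imset (mem (inversions w)) (can_inj fK)).
have gK : cancel g f by case=> x y; rewrite /f /g /= !permKV.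
congr #|pred_of_set _|; rewrite (can_imset_pre _ fK).
by apply/setP=> -[x y]; rewrite !inE /= !permKV andbC.
Qed.

Lemma ninv1 : ninv 1%g = 0.
Proof.
apply/eqP; rewrite cards_eq0; apply/eqP/setP=> p; rewrite !inE !perm1.
by case: ltngtP.
Qed.

Lemma ninv_eq0 w : ninv w = 0 -> w = 1%g.
Proof.
have up v : ninv v = 0 -> forall x : 'I_n, (x <= v x)%N.
  move/eqP; rewrite cards_eq0 => /eqP v0.
  have mono (x y : 'I_n) : (x < y)%N -> (v x < v y)%N.
    move=> ltxy; rewrite perm_lt_neq -?val_eqE ?ltn_eqF //.
    by have /setP/(_ (x, y)) := v0; rewrite !inE /= ltxy /= => ->.
  case=> x; elim: x => // x IHx ltxn.
  exact: leq_ltn_trans (IHx (ltnW ltxn)) (mono (Ordinal _) (Ordinal _) _).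
move=> w0; apply/permP=> x; rewrite perm1; apply/val_inj/eqP.
rewrite eqn_leq (up w w0) andbT.
by have := up w^-1%g _ (w x); rewrite permK ninvV => ->.
Qed.

Lemma ex_desc w : w != 1%g ->
  exists i, (w (ord_hi i) < w (ord_lo i))%N.
Proof.
move=> nw1; apply/existsP; apply: contraR nw1 => /existsPn asc.
apply/eqP/ninv_eq0/eqP; rewrite cards_eq0; apply/eqP/setP=> -[x y].
rewrite !inE /=; apply/negbTE/negP=> /andP[].
case: y => y; elim: y => // y IHy ltyn; rewrite ltnS => lexy /=.
have lty1 : (y < n.-1)%N by case: {+}n ltyn.
have loE : ord_lo (Ordinal lty1) = Ordinal (ltnW ltyn) by apply: val_inj.
have hiE : ord_hi (Ordinal lty1) = Ordinal ltyn by apply: val_inj.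
have := asc (Ordinal lty1); rewrite loE hiE -leqNgt => le1 lt2.
move: lexy; rewrite leq_eqVlt => /predU1P[exy|ltxy].
  have ex : x = Ordinal (ltnW ltyn) by apply: val_inj.
  by move: lt2; rewrite ex ltnNge le1.
exact: (IHy (ltnW ltyn) ltxy (leq_ltn_trans le1 lt2)).
Qed.

Lemma wprod_ninv w : exists2 u, size u = ninv w & wprod u = w.
Proof.
have [k] := ubnP (ninv w); elim: k w => // k IHk w ltwk.
have [->|/ex_desc[i /[dup] desc /ninv_desc wE]] := eqVneq w 1%g.
  by exists [::]; rewrite ?ninv1 // wprod_nil.
have [|u su uE] := IHk (sref i * w)%g; first by rewrite -ltnS -wE.
by exists (i :: u); rewrite /= ?su // wprod_cons uE srefKl.
Qed.

Lemma ell_subproof w :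
  exists k, [exists u : k.-tuple 'I_n.-1, wprod u == w].
Proof.
have [u _ uE] := wprod_ninv w; exists (size u).
by apply/existsP; exists (in_tuple u); rewrite uE.
Qed.

Definition ell w : nat := ex_minn (ell_subproof w).

Definition reduced u := size u == ell (wprod u).

Lemma ell_word w : exists u : (ell w).-tuple 'I_n.-1, wprod u == w.
Proof. by apply/existsP; rewrite /ell; case: ex_minnP. Qed.

Definition redword w : seq 'I_n.-1 := xchoose (ell_word w).

Lemma wprod_redword w : wprod (redword w) = w.
Proof. exact/eqP/(xchooseP (ell_word w)). Qed.

Lemma redword_reduced w : reduced (redword w).
Proof. by rewrite /reduced wprod_redword size_tuple. Qed.

Lemma ell_wprod u : (ell (wprod u) <= size u)%N.
Proof.
rewrite /ell; case: ex_minnP => k _; apply.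
by apply/existsP; exists (in_tuple u).
Qed.

Lemma ninv_srefl i w : ninv (sref i * w)%g =
  if (w (ord_hi i) < w (ord_lo i))%N then (ninv w).-1 else (ninv w).+1.
Proof.
case: ifP => [/ninv_desc-> //|/negbT]; rewrite -perm_lt_neq ?lo_neq_hi //.
exact: ninv_asc.
Qed.

Lemma ellE w : ell w = ninv w.
Proof.
apply/eqP; rewrite eqn_leq; apply/andP; split.
  by have [u <- uE] := wprod_ninv w; rewrite -{1}uE ell_wprod.
rewrite -{1}(wprod_redword w) (_ : ell w = size (redword w)); last first.
  by rewrite size_tuple.
elim: (redword w) => [|i u IHu].
  by rewrite wprod_nil ninv1.
rewrite wprod_cons /= ninv_srefl.
case: ifP => _; rewrite ?ltnS //.
by rewrite -ltnS (leq_ltn_trans (leq_pred _)) ?ltnS ?leqW.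
Qed.

Definition ldesc i w := (ell (sref i * w) < ell w)%N.
Definition rdesc i w := (ell (w * sref i) < ell w)%N.

Lemma ldescE i w : ldesc i w = (w (ord_hi i) < w (ord_lo i))%N.
Proof.
rewrite /ldesc !ellE; case: ifP (ninv_srefl i w) => [/ninv_desc-> _|_ ->].
  by rewrite ltnS leqnn.
by rewrite ltnNge leqnSn.
Qed.

Lemma ell_srefl i w :
  ell (sref i * w)%g = if ldesc i w then (ell w).-1 else (ell w).+1.
Proof. by rewrite ldescE !ellE ninv_srefl. Qed.

Lemma ellV w : ell w^-1%g = ell w. Proof. by rewrite !ellE ninvV. Qed.

Lemma rdescV i w : rdesc i w = ldesc i w^-1%g.
Proof. by rewrite /ldesc /rdesc -(ellV (w * _)) -(ellV w) invMg srefV. Qed.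

Lemma rdescE i w :
  rdesc i w = (w^-1%g (ord_hi i) < w^-1%g (ord_lo i))%N.
Proof. by rewrite rdescV ldescE. Qed.

Lemma ldesc_srefl i w : ldesc i (sref i * w)%g = ~~ ldesc i w.
Proof. by rewrite !ldescE !permM sref_lo sref_hi perm_lt_neq ?lo_neq_hi. Qed.

Lemma rdesc_srefr i w : rdesc i (w * sref i)%g = ~~ rdesc i w.
Proof. by rewrite !rdescV invMg srefV ldesc_srefl. Qed.

Lemma ldesc_srefr i j w : (sref i * w != w * sref j)%g ->
  ldesc i (w * sref j)%g = ldesc i w.
Proof.
rewrite conjgC (inj_eq (mulgI w)) tpermJ => neq.
rewrite !ldescE !permM sref_mono //; apply: contraNneq neq => -[-> ->] //.
by rewrite tpermC.
Qed.

Lemma rdesc_srefl i j w : (sref i * w != w * sref j)%g ->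
  rdesc j (sref i * w)%g = rdesc j w.
Proof.
move=> neq; rewrite !rdescV invMg srefV ldesc_srefr //.
by rewrite -(inj_eq invg_inj) !invMg !invgK !srefV eq_sym.
Qed.

Lemma ldesc_rdesc i j w : (sref i * w = w * sref j)%g ->
  ldesc i w = rdesc j w.
Proof. by rewrite /ldesc /rdesc => ->. Qed.

Lemma ell1 : ell 1%g = 0. Proof. by rewrite ellE ninv1. Qed.

Lemma ell_eq0 w : ell w = 0 -> w = 1%g.
Proof. by rewrite ellE => /ninv_eq0. Qed.

Lemma reduced_cons i u :
  reduced (i :: u) -> ~~ ldesc i (wprod u) /\ reduced u.
Proof.
rewrite /reduced wprod_cons /= ell_srefl => /eqP su.
have := ell_wprod u; case: ifP su => // _; last by case=> ->.
by move=> su le; lia.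
Qed.

Lemma reduced_redword i v : ldesc i v -> let c := redword (sref i * v)%g in
  reduced (i :: c) /\ wprod (i :: c) = v.
Proof.
move=> di c; have cE : wprod (i :: c) = v.
  by rewrite wprod_cons wprod_redword srefKl.
split=> //; rewrite /reduced cE /= size_tuple ell_srefl di.
by rewrite prednK //; apply: leq_ltn_trans di.
Qed.

Lemma reduced_consI i u :
  reduced u -> ~~ ldesc i (wprod u) -> reduced (i :: u).
Proof.
rewrite /reduced wprod_cons ell_srefl => /eqP /= -> /negbTE ->.
by [].
Qed.

Lemma sref_far i j : (i.+1 < j)%N || (j.+1 < i)%N ->
  sref i (ord_lo j) = ord_lo j /\ sref i (ord_hi j) = ord_hi j.
Proof.
move=> far; split; apply/ord_inj; rewrite srefP /=;
  by split_ifs; lia.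
Qed.

Lemma sref_near i j : j = i.+1 :> nat -> [/\ ord_lo j = ord_hi i,
  sref i (ord_hi j) = ord_hi j & sref j (ord_lo i) = ord_lo i].
Proof.
move=> ij; split; apply/ord_inj; rewrite ?srefP /= ?ij //;
  by split_ifs; lia.
Qed.

Lemma sref_comm i j : (i.+1 < j)%N -> (sref i * sref j = sref j * sref i)%g.
Proof.
move=> ltij; have far : (i.+1 < j)%N || (j.+1 < i)%N by rewrite ltij.
have [flo fhi] := sref_far far.
by rewrite (conjgC (sref j)) tpermJ flo fhi.
Qed.

Lemma sref_braid i j : j = i.+1 :> nat ->
  (sref i * sref j * sref i = sref j * sref i * sref j)%g.
Proof.
move=> /sref_near[lohi fi fj].
rewrite -{1}(srefV i) -{2}(srefV j) -!mulgA -!conjgE !tpermJ.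
by rewrite fi lohi sref_hi fj -lohi sref_lo.
Qed.

End SymmetricGroup.

(* The Iwahori-Hecke algebra of S_n over R with parameter xi: an element is the
   family of its coordinates in the basis T_w, and the product is the one for
   which left multiplication by T_s is [lop].  Lemmas [hgen_rel], [hT_reduced],
   [hecke_ext] and [hecke_ext_uniq] below show that this is the algebra
   presented by the braid and quadratic relations.                           *)
Definition hecke (R : comNzRingType) (xi : R) (n : nat) : Type :=
  {ffun 'S_n -> R^o}.

HB.instance Definition _ (R : comNzRingType) (xi : R) (n : nat) :=
  GRing.Lmodule.copy (hecke xi n) {ffun 'S_n -> R^o}.

Section HeckeProduct.

Variables (R : comNzRingType) (xi : R) (n : nat).
Local Notation H := (hecke xi n).
Implicit Types (i j : 'I_n.-1) (v w : 'S_n) (u : seq 'I_n.-1) (h x y z : H).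

Definition hcoord h : 'S_n -> R := fun w => (h : {ffun _ -> _}) w.

Definition hT w : H := [ffun v => (v == w)%:R].

(* T_s T_w is T_{sw} if l(sw) > l(w), and T_{sw} + xi T_w otherwise. *)
Definition lop i h : H :=
  [ffun w => hcoord h (sref i * w)%g
               + (if ldesc i w then xi * hcoord h w else 0)].

Definition rop i h : H :=
  [ffun w => hcoord h (w * sref i)%g
               + (if rdesc i w then xi * hcoord h w else 0)].

Definition lword u h := foldr lop h u.

Definition hmul x y : H := \sum_w hcoord x w *: lword (redword w) y.

Lemma hcoordP x y : hcoord x =1 hcoord y -> x = y.
Proof. by move=> exy; apply/ffunP. Qed.

Lemma hcoordT v w : hcoord (hT w) v = (v == w)%:R.
Proof. by rewrite /hcoord ffunE. Qed.

Lemma hcoord_sum (I : Type) (r : seq I) (P : pred I) (F : I -> H) w :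
  hcoord (\sum_(i <- r | P i) F i) w = \sum_(i <- r | P i) hcoord (F i) w.
Proof. exact: (@sum_ffunE _ R^o _ r P F w). Qed.

Lemma hcoordZ a x w : hcoord (a *: x) w = a * hcoord x w.
Proof. by rewrite /hcoord ffunE. Qed.

Lemma hcoordD x y w : hcoord (x + y) w = hcoord x w + hcoord y w.
Proof. by rewrite /hcoord ffunE. Qed.

Lemma hexp h : h = \sum_w hcoord h w *: hT w.
Proof.
apply: hcoordP => v; rewrite hcoord_sum (bigD1 v) //= hcoordZ hcoordT eqxx.
rewrite mulr1 big1 ?addr0 // => w nwv.
by rewrite hcoordZ hcoordT eq_sym (negbTE nwv) mulr0.
Qed.

Lemma lop_coord i h w : hcoord (lop i h) w =
  hcoord h (sref i * w)%g + (if ldesc i w then xi * hcoord h w else 0).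
Proof. by rewrite {1}/hcoord ffunE. Qed.

Lemma rop_coord i h w : hcoord (rop i h) w =
  hcoord h (w * sref i)%g + (if rdesc i w then xi * hcoord h w else 0).
Proof. by rewrite {1}/hcoord ffunE. Qed.

Lemma lop_is_linear i : linear (lop i).
Proof.
move=> a x y; apply: hcoordP => w.
rewrite !(hcoordD, hcoordZ, lop_coord) [a * (_ + _)]mulrDr addrACA.
by case: ifP => _; rewrite ?(mulr0, addr0) // mulrDr mulrCA.
Qed.
HB.instance Definition _ i := GRing.isLinear.Build R H H _ (lop i)
  (lop_is_linear i).

Lemma rop_is_linear i : linear (rop i).
Proof.
move=> a x y; apply: hcoordP => w.
rewrite !(hcoordD, hcoordZ, rop_coord) [a * (_ + _)]mulrDr addrACA.
by case: ifP => _; rewrite ?(mulr0, addr0) // mulrDr mulrCA.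
Qed.
HB.instance Definition _ i := GRing.isLinear.Build R H H _ (rop i)
  (rop_is_linear i).

Lemma lop_rop i j h : lop i (rop j h) = rop j (lop i h).
Proof.
apply: hcoordP => w.
rewrite lop_coord !rop_coord !lop_coord [(sref i * (_ * _))%g]mulgA.
have [e|ne] := eqVneq (sref i * w)%g (w * sref j)%g.
  rewrite -(ldesc_rdesc e) -e ldesc_srefl {2}e rdesc_srefr -(ldesc_rdesc e).
  by case: ifP.
rewrite (ldesc_srefr ne) (rdesc_srefl ne).
by do 2!case: ifP => _; rewrite ?addr0 // !mulrDr addrACA.
Qed.

Lemma lword_is_linear u : linear (lword u).
Proof. by elim: u => // i u IHu a x y; rewrite /= IHu linearP. Qed.
HB.instance Definition _ u := GRing.isLinear.Build R H H _ (lword u)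
  (lword_is_linear u).

Lemma lword_rop u j h : lword u (rop j h) = rop j (lword u h).
Proof. by elim: u => //= i u ->; rewrite lop_rop. Qed.

Lemma hmulE x y : hmul x y = \sum_w hcoord x w *: lword (redword w) y.
Proof. by []. Qed.

Lemma hmul_is_linear x : linear (hmul x).
Proof.
move=> a y z; rewrite /hmul scaler_sumr -big_split; apply: eq_bigr => w _ /=.
by rewrite linearP scalerDr !scalerA mulrC.
Qed.
HB.instance Definition _ x := GRing.isLinear.Build R H H _ (hmul x)
  (hmul_is_linear x).

Lemma hmul_rop j x y : hmul x (rop j y) = rop j (hmul x y).
Proof.
rewrite /hmul linear_sum; apply: eq_bigr => w _.
by rewrite lword_rop linearZ.
Qed.

Lemma lop_asc i w : ~~ ldesc i w -> lop i (hT w) = hT (sref i * w)%g.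
Proof.
move=> asc; apply: hcoordP => v; rewrite lop_coord !hcoordT.
rewrite -(inj_eq (mulgI (sref i)) _ w) srefKl.
have [->|_] := eqVneq v w; first by rewrite (negbTE asc) addr0.
by rewrite mulr0 if_same addr0.
Qed.

Lemma lop_desc i w :
  ldesc i w -> lop i (hT w) = hT (sref i * w)%g + xi *: hT w.
Proof.
move=> desc; apply: hcoordP => v.
rewrite lop_coord hcoordD hcoordZ !hcoordT.
rewrite -(inj_eq (mulgI (sref i)) _ w) srefKl; congr (_ + _).
by have [->|_] := eqVneq v w; rewrite ?desc // mulr0 if_same.
Qed.

Lemma rop_asc i w : ~~ rdesc i w -> rop i (hT w) = hT (w * sref i)%g.
Proof.
move=> asc; apply: hcoordP => v; rewrite rop_coord !hcoordT.
rewrite -(inj_eq (mulIg (sref i)) _ w) srefKr.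
have [->|_] := eqVneq v w; first by rewrite (negbTE asc) addr0.
by rewrite mulr0 if_same addr0.
Qed.

Lemma lword1 u : reduced u -> lword u (hT 1%g) = hT (wprod u).
Proof.
elim: u => [|i u IHu]; first by rewrite wprod_nil.
by case/reduced_cons=> asc /IHu /= ->; rewrite lop_asc // wprod_cons.
Qed.

Lemma hmulr1 : right_id (hT 1%g) hmul.
Proof.
move=> x; rewrite [RHS]hexp /hmul; apply: eq_bigr => w _.
by rewrite lword1 ?redword_reduced // wprod_redword.
Qed.

Lemma eq_rop_lin (f g : {linear H -> H}) :
    (forall j x, f (rop j x) = rop j (f x)) ->
    (forall j x, g (rop j x) = rop j (g x)) ->
  f (hT 1%g) = g (hT 1%g) -> f =1 g.
Proof.
move=> fR gR fg1 x; rewrite (hexp x) !linear_sum; apply: eq_bigr => w _.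
rewrite !linearZ /=; congr (_ *: _).
have [k] := ubnP (ell w); elim: k w => // k IHk w.
have [->//|nw1] := eqVneq w 1%g; rewrite ltnS => lewk.
have [j dj] : exists j, rdesc j w.
  have /ex_desc[j] : w^-1%g != 1%g by rewrite invg_eq1.
  by rewrite -rdescE; exists j.
have wE : hT w = rop j (hT (w * sref j)%g).
  by rewrite rop_asc ?srefKr // rdesc_srefr negbK.
by rewrite wE fR gR IHk // (leq_trans dj).
Qed.

Lemma hmul1r : left_id (hT 1%g) hmul.
Proof.
apply: (@eq_rop_lin (hmul (hT 1%g)) idfun) => // [j x|]; first exact: hmul_rop.
exact: hmulr1.
Qed.

Lemma hmulA : associative hmul.
Proof.
move=> x y z; apply/esym.
apply: (@eq_rop_lin (hmul (hmul x y)) (hmul x \o hmul y)) => [j h|j h|].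
- exact: hmul_rop.
- by rewrite /= !hmul_rop.
- by rewrite /= !hmulr1.
Qed.

Lemma hmulDl : left_distributive hmul +%R.
Proof.
move=> x y z; rewrite /hmul -big_split; apply: eq_bigr => w _ /=.
by rewrite hcoordD scalerDl.
Qed.

Lemma hmulDr : right_distributive hmul +%R.
Proof. by move=> x y z; rewrite linearD. Qed.

Lemma hT1_neq0 : hT 1%g != 0.
Proof.
apply/eqP=> /(congr1 (hcoord^~ 1%g)) /eqP; rewrite hcoordT eqxx.
by rewrite /hcoord ffunE oner_eq0.
Qed.

Lemma hmulZl a x y : a *: hmul x y = hmul (a *: x) y.
Proof.
rewrite /hmul scaler_sumr; apply: eq_bigr => w _.
by rewrite hcoordZ scalerA.
Qed.

Lemma hmulZr a x y : a *: hmul x y = hmul x (a *: y).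
Proof. by rewrite linearZ. Qed.

HB.instance Definition _ := GRing.Zmodule_isNzRing.Build H
  hmulA hmul1r hmulr1 hmulDl hmulDr hT1_neq0.
HB.instance Definition _ := GRing.Lmodule_isLalgebra.Build R H hmulZl.
HB.instance Definition _ := GRing.Lalgebra_isAlgebra.Build R H hmulZr.

End HeckeProduct.

Section Presentation.

Variables (R : comNzRingType) (xi : R) (n : nat).
Local Notation H := (hecke xi n).
Implicit Types (i j : 'I_n.-1) (v w : 'S_n) (u : seq 'I_n.-1) (h x y z : H).

Definition hecke_rel (A : algType R) (t : 'I_n.-1 -> A) : Prop :=
  [/\ forall i j, (i.+1 < j)%N -> t i * t j = t j * t i,
      forall i j, j = i.+1 :> nat -> t i * t j * t i = t j * t i * t j
    & forall i, t i ^+ 2 = 1 + xi *: t i].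

Definition hgen i : H := hT xi (sref i).

Lemma hT1 : hT xi 1%g = 1 :> H. Proof. by []. Qed.

Lemma ldesc1 i : ~~ ldesc i (1%g : 'S_n).
Proof. by rewrite ldescE !perm1 -leqNgt /=. Qed.

Lemma hgenM i h : hgen i * h = lop i h.
Proof.
apply: (@eq_rop_lin _ _ _ (hmul (hgen i)) (lop i)) => [j y|j y|].
- exact: hmul_rop.
- exact: lop_rop.
- by rewrite /= lop_asc ?ldesc1 // mulg1 [LHS]hmulr1.
Qed.

Lemma hgen_asc i w : ~~ ldesc i w -> hgen i * hT xi w = hT xi (sref i * w)%g.
Proof. by rewrite hgenM; apply: lop_asc. Qed.

Lemma hgen_desc i w : ldesc i w ->
  hgen i * hT xi w = hT xi (sref i * w)%g + xi *: hT xi w.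
Proof. by rewrite hgenM; apply: lop_desc. Qed.

Lemma lwordE u h : lword u h = (\prod_(i <- u) hgen i) * h.
Proof.
elim: u => [|i u /= ->]; first by rewrite big_nil mul1r.
by rewrite big_cons -mulrA hgenM.
Qed.

Lemma hT_reduced u : reduced u -> hT xi (wprod u) = \prod_(i <- u) hgen i.
Proof. by move/lword1 => /(_ R xi) <-; rewrite lwordE hT1 mulr1. Qed.

Lemma hgen_rel : hecke_rel hgen.
Proof.
split=> [i j ltij|i j ij|i].
- have asc2 i' j' : (i'.+1 < j')%N || (j'.+1 < i')%N ->
      ~~ ldesc i' (sref j').
    move=> far; rewrite ldescE -leqNgt.
    by have [|-> ->] := @sref_far n j' i'; [rewrite orbC | rewrite /=].
  by rewrite !hgen_asc ?asc2 ?ltij ?orbT // sref_comm.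
- have [lohi fi fj] := sref_near ij.
  have e1 : sref i (ord_lo j) = ord_lo i by rewrite lohi sref_hi.
  have e2 : sref j (ord_hi i) = ord_hi j by rewrite -lohi sref_lo.
  rewrite -!mulrA !hgen_asc ?ldescE -?leqNgt ?permM;
    rewrite ?(e1, e2, fi, fj, sref_lo, sref_hi) /= ?ij;
    rewrite ?(leqW (leqnSn _)) ?leqnSn ?leqnn //.
  by rewrite !mulgA sref_braid.
- rewrite [LHS]expr2 hgen_desc ?srefK // -[sref i]mulg1 ldesc_srefl.
  exact: ldesc1.
Qed.

Section Universal.

Variables (A : algType R) (t : 'I_n.-1 -> A) (tP : hecke_rel t).

Lemma reduced_prod u u' : reduced u -> reduced u' -> wprod u = wprod u' ->
  \prod_(i <- u) t i = \prod_(i <- u') t i.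
Proof.
have [k] := ubnP (size u); elim: k u u' => // k IHk.
move=> [|i u] u' ltuk ru ru' uu'.
  move: ru'; rewrite /reduced -uu' wprod_nil ell1.
  by case: u' {uu'} => // _; rewrite !big_nil.
case: u' ru' uu' => [|j u'] ru' uu'.
  by move: ru; rewrite /reduced uu' wprod_nil ell1.
have suu' : size u' = size u.
  by move: ru ru'; rewrite /reduced -uu' => /eqP <- /eqP [].
have ltk : (size u < k)%N by [].
have ltk' : (size u' < k)%N by rewrite suu'.
set w := wprod (i :: u).
have wu : wprod u = (sref i * w)%g by rewrite /w wprod_cons srefKl.
have wu' : wprod u' = (sref j * w)%g by rewrite /w uu' wprod_cons srefKl.
have [di ru1] : ldesc i w /\ reduced u.
  by have [] := reduced_cons ru; rewrite wu ldesc_srefl negbK.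
have [dj ru1'] : ldesc j w /\ reduced u'.
  by have [] := reduced_cons ru'; rewrite wu' ldesc_srefl negbK.
move: uu' wu wu' di dj => _; move: (w) => {ltuk ru ru' suu'}w wu wu' di dj.
wlog leij : i j u u' ltk ltk' wu wu' di dj ru1 ru1' / (i <= j)%N.
  move=> th; have [|/ltnW] := leqP i j; first exact: th.
  by move=> leji; symmetry; apply: th.
move: leij; rewrite leq_eqVlt => /predU1P[/ord_inj eij|ltij].
  by rewrite -eij in wu' *; rewrite !big_cons (IHk u u') // wu wu'.
have [t2 t3 _] := tP.
rewrite !big_cons; move: ltij; rewrite leq_eqVlt => /predU1P[ij|ltij].
  have [lohi fi fj] := sref_near (esym ij).
  have e1 : sref i (ord_lo j) = ord_lo i by rewrite lohi sref_hi.
  have e2 : sref j (ord_hi i) = ord_hi j by rewrite -lohi sref_lo.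
  have lt1 : (w (ord_hi j) < w (ord_hi i))%N by rewrite -lohi -ldescE.
  have lt2 : (w (ord_hi i) < w (ord_lo i))%N by rewrite -ldescE.
  have lt3 := ltn_trans lt1 lt2.
  pose w3 := (sref i * (sref j * (sref i * w)))%g.
  have w3E : w3 = (sref j * (sref i * (sref j * w)))%g.
    by rewrite /w3 !mulgA sref_braid.
  pose c := redword w3.
  have wc : wprod c = w3 by apply: wprod_redword.
  have rc : reduced c by apply: redword_reduced.
  have wjc : wprod (j :: c) = (sref i * (sref j * w))%g.
    by rewrite wprod_cons wc w3E srefKl.
  have wic : wprod (i :: c) = (sref j * (sref i * w))%g.
    by rewrite wprod_cons wc srefKl.
  have rjc : reduced (j :: c).
    apply: reduced_consI => //; rewrite wc w3E ldesc_srefl negbK ldescE !permM.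
    by rewrite fi e1 sref_hi fj lohi.
  have ric : reduced (i :: c).
    apply: reduced_consI => //; rewrite wc ldesc_srefl negbK ldescE !permM.
    by rewrite e2 fi fj sref_lo.
  have rijc : reduced [:: i, j & c].
    apply: reduced_consI => //; rewrite wjc ldesc_srefl negbK ldescE !permM.
    by rewrite e2 fj.
  have rjic : reduced [:: j, i & c].
    apply: reduced_consI => //; rewrite wic ldesc_srefl negbK ldescE !permM.
    by rewrite fi e1.
  rewrite (IHk u [:: j, i & c]) // ?(IHk u' [:: i, j & c]) //.
  - by rewrite !big_cons !mulrA t3.
  - by rewrite wprod_cons wjc srefKl.
  - by rewrite wprod_cons wic srefKl.
have far1 : (i.+1 < j)%N || (j.+1 < i)%N by rewrite ltij.
have far2 : (j.+1 < i)%N || (i.+1 < j)%N by rewrite orbC.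
have [loj hij] := sref_far far1; have [loi hii] := sref_far far2.
pose w2 := (sref i * (sref j * w))%g; pose c := redword w2.
have w2E : w2 = (sref j * (sref i * w))%g by rewrite /w2 !mulgA sref_comm.
have wc : wprod c = w2 by apply: wprod_redword.
have rc : reduced c by apply: redword_reduced.
have ric : reduced (i :: c).
  apply: reduced_consI => //; rewrite wc ldesc_srefl negbK ldescE !permM.
  by rewrite loi hii -ldescE.
have rjc : reduced (j :: c).
  apply: reduced_consI => //; rewrite wc w2E ldesc_srefl negbK ldescE !permM.
  by rewrite loj hij -ldescE.
rewrite (IHk u (j :: c)) // ?(IHk u' (i :: c)) //.
- by rewrite !big_cons !mulrA t2.
- by rewrite wprod_cons wc srefKl.
- by rewrite wprod_cons wc w2E srefKl.
Qed.

Definition hext h : A := \sum_w hcoord h w *: \prod_(i <- redword w) t i.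

Lemma hext_is_linear : linear hext.
Proof.
move=> a x y; rewrite /hext scaler_sumr -big_split; apply: eq_bigr => w _ /=.
by rewrite hcoordD hcoordZ scalerDl scalerA.
Qed.
HB.instance Definition _ := GRing.isLinear.Build R H A _ hext hext_is_linear.

Lemma hextT w : hext (hT xi w) = \prod_(i <- redword w) t i.
Proof.
rewrite /hext (bigD1 w) //= hcoordT eqxx scale1r.
rewrite [X in _ + X]big1 ?addr0 // => v nvw.
by rewrite hcoordT (negbTE nvw) scale0r.
Qed.

Lemma hext_reduced u : reduced u -> hext (hT xi (wprod u)) = \prod_(i <- u) t i.
Proof.
move=> ru; rewrite hextT.
by apply: reduced_prod => //; rewrite ?redword_reduced ?wprod_redword.
Qed.

Lemma hext_lop i h : hext (lop i h) = t i * hext h.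
Proof.
have asc w : ~~ ldesc i w ->
    t i * hext (hT xi w) = hext (hT xi (sref i * w)%g).
  move=> ai; have [wE rw] := (wprod_redword w, redword_reduced w).
  have riw : reduced (i :: redword w) by apply: reduced_consI; rewrite ?wE.
  by have := hext_reduced riw; rewrite wprod_cons wE big_cons -hextT.
rewrite (hexp h) !linear_sum mulr_sumr; apply: eq_bigr => w _.
rewrite !linearZ /= -scalerAr; congr (_ *: _).
have [di|ai] := boolP (ldesc i w); last by rewrite lop_asc // asc.
have ai : ~~ ldesc i (sref i * w)%g by rewrite ldesc_srefl negbK.
have := asc _ ai; rewrite srefKl lop_desc // linearD linearZ /= => <-.
rewrite mulrA -expr2; have [_ _ ->] := tP.
by rewrite mulrDl mul1r scalerAl.
Qed.

Lemma hext_is_monoid_morphism : monoid_morphism hext.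
Proof.
have e1 : hext 1 = 1.
  by have := @hext_reduced [::]; rewrite /reduced wprod_nil ell1 big_nil => ->.
have ext_lword u y : hext (lword u y) = (\prod_(i <- u) t i) * hext y.
  elim: u => [|i u IHu]; first by rewrite big_nil mul1r.
  by rewrite big_cons -mulrA -IHu /= hext_lop.
split=> // x y; rewrite [x * y]/(hmul x y) /hmul linear_sum mulr_suml.
by apply: eq_bigr => w _; rewrite linearZ /= ext_lword scalerAl.
Qed.
HB.instance Definition _ :=
  GRing.isMonoidMorphism.Build H A hext hext_is_monoid_morphism.

Lemma hext_gen i : hext (hgen i) = t i.
Proof.
by rewrite -[hgen i]mulr1 hgenM hext_lop rmorph1 mulr1.
Qed.

Lemma hecke_ext : exists f : {lrmorphism H -> A}, forall i, f (hgen i) = t i.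
Proof. by exists (hext : {lrmorphism H -> A}) => i; apply: hext_gen. Qed.

End Universal.

Lemma hecke_ext_uniq (A : algType R) (f g : {lrmorphism H -> A}) :
  (forall i, f (hgen i) = g (hgen i)) -> f =1 g.
Proof.
move=> fg x; rewrite (hexp x) !linear_sum; apply: eq_bigr => w _.
rewrite !linearZ /=; congr (_ *: _).
rewrite -[w]wprod_redword hT_reduced ?redword_reduced // !rmorph_prod.
by apply: eq_bigr => i _; apply: fg.
Qed.

End Presentation.

Definition is_composition (n : nat) (lam : seq nat) :=
  all (fun p => 0 < p)%N lam && (sumn lam == n).

Definition is_partition (n : nat) (lam : seq nat) :=
  is_composition n lam && sorted geq lam.

Definition comp_minus1 (lam : seq nat) : seq nat :=
  flatten [seq if (1 < p)%N then [:: p.-1; 1%N] else [:: p] | p <- lam].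

Definition block_start (lam : seq nat) (i : nat) : nat := sumn (take i lam).

(* Indices (from 0) of the simple reflections of S_lam, in increasing order. *)
Definition par_idx (lam : seq nat) : seq nat :=
  flatten [seq iota (block_start lam i) (nth 0%N lam i).-1
              | i <- iota 0%N (size lam)].

(* When lam is a composition of n all the indices are < n.-1, so that [pmap]
   drops none of them.                                                       *)
Definition par_simple (n : nat) (lam : seq nat) : seq 'I_n.-1 :=
  pmap insub (par_idx lam).

Definition par_group (n : nat) (lam : seq nat) : {group 'S_n} :=
  <<[set sref i | i in par_simple n lam]>>%G.

Definition par_coxeter (n : nat) (lam : seq nat) : 'S_n :=
  wprod (par_simple n lam).

Definition block (n : nat) (lam : seq nat) (i : nat) : {set 'I_n} :=
  [set x : 'I_n | (block_start lam i <= x < block_start lam i + nth 0 lam i)%N].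

(* For w stabilising B: the lengths of the cycles (fixed points included) of
   the restriction of w to B, in decreasing order.                           *)
Definition cycle_type (n : nat) (B : {set 'I_n}) (w : 'S_n) : seq nat :=
  sort geq
    [seq #|o| | o : {set 'I_n} <- enum (porbits w) & o \subset B].

Definition sym_class (n : nat) (alpha : seq nat) : {set 'S_n} :=
  [set w | cycle_type [set: 'I_n] w == alpha].

Definition par_class (n : nat) (lam : seq nat) (th : seq (seq nat)) :
    {set 'S_n} :=
  [set w in par_group n lam |
     [seq cycle_type (block n lam i) w | i <- iota 0%N (size lam)] == th].

Definition is_multipartition (lam : seq nat) (th : seq (seq nat)) :=
  all2 is_partition lam th.

Definition mp_seqs (N r : nat) (t : r.-tuple (N.-bseq 'I_N.+1)) :
    seq (seq nat) :=
  [seq map val (bseqval p) | p <- t].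

(* Candidates are enumerated as tuples of sequences of length at most |lam| of
   numbers at most |lam|; see [mem_Lambda] and [Lambda_uniq].                *)
Definition Lambda (lam alpha : seq nat) : seq (seq (seq nat)) :=
  [seq th <- map (@mp_seqs _ _)
               (enum {: (size lam).-tuple ((sumn lam).-bseq 'I_(sumn lam).+1)})
     | is_multipartition lam th && perm_eq (flatten th) alpha].

Lemma mem_Lambda lam alpha th : (th \in Lambda lam alpha) =
  is_multipartition lam th && perm_eq (flatten th) alpha.
Proof.
rewrite mem_filter andb_idr // => /andP[].
rewrite /is_multipartition all2E => /andP[/eqP sz th_lam] _.
set N := sumn lam.
have bnd p : p \in th -> (size p <= N)%N && all (fun k => k <= N)%N p.
  move=> /(nthP [::])[i lti <-].
  have: (lam`_i, nth [::] th i) \in zip lam th.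
    rewrite -[_ `_i]/(nth 0%N lam i) -nth_zip //.
    by rewrite mem_nth // size_zip sz minnn.
  move/(allP th_lam)=> /=; move: (nth [::] th i) => q.
  move=> /andP[/andP[qpos /eqP qE] _].
  have qN : (sumn q <= N)%N.
    rewrite qE /N -[X in (_ <= sumn X)%N](cat_take_drop i lam) sumn_cat.
    by rewrite (drop_nth 0%N) ?sz //= addnCA leq_addr.
  have [sq aq] : (size q <= sumn q)%N /\ all (fun k => k <= sumn q)%N q.
    elim: (q) qpos => //= k s IHs /andP[k0 /IHs[le1 le2]].
    split; first by rewrite -add1n leq_add.
    rewrite leq_addr; apply: sub_all le2 => m /leq_trans; apply.
    exact: leq_addl.
  rewrite (leq_trans sq) //=; apply: sub_all aq => m /leq_trans; exact.
pose enc (p : seq nat) : N.-bseq 'I_N.+1 := insub_bseq N (map inord p).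
have encK p : p \in th -> map val (enc p : seq 'I_N.+1) = p.
  move=> /bnd/andP[sp ap].
  rewrite /enc /insub_bseq insubdK -?topredE /= ?size_map //.
  rewrite -map_comp map_id_in // => k kp /=.
  by rewrite inordK // ltnS (allP ap).
have szt : size (map enc th) == size lam by rewrite size_map sz.
apply/mapP; exists (Tuple szt); first by rewrite mem_enum.
rewrite /mp_seqs /= -map_comp -[LHS]map_id; apply/eq_in_map => p pth /=.
by rewrite encK.
Qed.

Lemma Lambda_uniq lam alpha : uniq (Lambda lam alpha).
Proof.
rewrite filter_uniq // map_inj_uniq ?enum_uniq // => t1 t2.
rewrite /mp_seqs => e12; apply/val_inj; move: e12; apply: inj_map => p1 p2.
by move/(inj_map val_inj)/val_inj.
Qed.

Section Norms.

Variables (R : comNzRingType) (xi : R) (n : nat).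
Local Notation H := (hecke xi n).

Definition min_reps (G K : {set 'S_n}) : {set 'S_n} :=
  [set d in G | [forall u in K, ell d <= ell (u * d)]]%N.

Definition relnorm (G K : {set 'S_n}) (h : H) : H :=
  \sum_(d in min_reps G K) hT xi d^-1%g * h * hT xi d.

Definition heta (lam : seq nat) : H :=
  relnorm (par_group n (comp_minus1 lam)) 1%g (hT xi (par_coxeter n lam)).

Definition hb (alpha : seq nat) : H :=
  relnorm [set: 'S_n] (par_group n alpha) (heta alpha).

(* The projection onto the span H_lam of the T_w with w in S_lam, followed by
   the inclusion of H_lam in H.                                              *)
Definition hproj (lam : seq nat) (h : H) : H :=
  \sum_(w in par_group n lam) hcoord h w *: hT xi w.

Lemma hproj_is_linear lam : linear (hproj lam).
Proof.
move=> a x y; rewrite /hproj scaler_sumr -big_split; apply: eq_bigr => w _ /=.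
by rewrite hcoordD hcoordZ scalerDl scalerA.
Qed.
HB.instance Definition _ lam :=
  GRing.isLinear.Build R H H _ (hproj lam) (hproj_is_linear lam).

Lemma hprojT lam w :
  hproj lam (hT xi w) = if w \in par_group n lam then hT xi w else 0.
Proof.
rewrite /hproj; case: ifP => wG.
  rewrite (bigD1 w) //= hcoordT eqxx scale1r big1 ?addr0 // => v /andP[_ nvw].
  by rewrite hcoordT (negbTE nvw) scale0r.
apply: big1 => v vG; rewrite hcoordT; case: eqP vG => [->|_ _].
  by rewrite wG.
by rewrite scale0r.
Qed.

End Norms.

Notation heckeZ n := (hecke ('X : {poly int}) n).
Notation heckeQ n := (hecke ('X : {poly rat}) n).

(* Extension of scalars from Z[xi] to Q[xi], needed to multiply by rationals. *)
Definition hextQ (n : nat) (h : heckeZ n) : heckeQ n :=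
  [ffun w => map_poly intr (hcoord h w)].

Section ExtQ.

Variable n : nat.
Local Notation extQ := (@hextQ n).

Lemma hextQ_coord h w : hcoord (extQ h) w = map_poly intr (hcoord h w).
Proof. by rewrite {1}/hcoord ffunE. Qed.

Lemma hextQ_inj : injective extQ.
Proof.
move=> x y exy; apply: hcoordP => w; apply/polyP=> k; apply: (@intr_inj rat).
by rewrite -!coef_map -!hextQ_coord exy.
Qed.

Lemma hextQ_is_zmod_morphism : zmod_morphism extQ.
Proof.
move=> x y; apply: hcoordP => w.
by rewrite -scaleN1r hextQ_coord hcoordD hcoordZ mulN1r rmorphB /hcoord !ffunE.
Qed.
HB.instance Definition _ :=
  GRing.isZmodMorphism.Build (heckeZ n) (heckeQ n) extQ hextQ_is_zmod_morphism.

Lemma hextQZ a h : extQ (a *: h) = map_poly intr a *: extQ h.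
Proof.
by apply: hcoordP => w; rewrite hcoordZ !hextQ_coord hcoordZ rmorphM.
Qed.

Lemma hextQT w : extQ (hT _ w) = hT _ w.
Proof.
by apply: hcoordP => v; rewrite hextQ_coord !hcoordT rmorph_nat.
Qed.

Lemma hextQ_is_monoid_morphism : monoid_morphism extQ.
Proof.
have e1 : extQ 1 = 1 by rewrite -hT1 hextQT hT1.
have ext_lop i h : extQ (lop i h) = lop i (extQ h).
  apply: hcoordP => w; rewrite hextQ_coord !lop_coord !hextQ_coord rmorphD.
  by case: ifP; rewrite ?rmorph0 // rmorphM /= map_polyX.
split=> // x y; rewrite [x * y]/(hmul x y) [RHS]/(hmul _ _) /hmul raddf_sum.
apply: eq_bigr => w _; rewrite /= hextQZ hextQ_coord; congr (_ *: _).
by elim: (redword w) => //= i u IHu; rewrite ext_lop IHu.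
Qed.
HB.instance Definition _ :=
  GRing.isMonoidMorphism.Build (heckeZ n) (heckeQ n) extQ
    hextQ_is_monoid_morphism.

End ExtQ.

(* Main.v *)
(* Standard parabolics [parab J] are indexed by sets J of simple reflections;
   [mrep J] is the set of minimal representatives of the cosets [parab J :* d].
   The element eta of a parabolic is a product of Jucys-Murphy elements, hence
   central in its subalgebra, and its support contains no element of a smaller
   parabolic.  In the Mackey formula for the projection to H_L of the norm of
   eta_J, only those minimal e thus survive whose conjugation carries parab J
   onto some parab K inside parab L, with contribution the norm of eta_K from
   parab K to parab L.  By centrality of eta this norm only depends on the
   class in parab L of the Coxeter element of K.  Multiplying by #|parab L|
   turns the sum over e into a sum over all g with (cox J)^g in parab L; the
   number of these landing in the class C_theta is |C_theta| |S_n| / |C_alpha|. *)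

Require Import Defs.
From HB Require Import structures.
From mathcomp Require Import all_boot all_order all_algebra all_fingroup.
From mathcomp Require Import zify.

Set Implicit Arguments.
Unset Strict Implicit.
Unset Printing Implicit Defensive.

Import GRing.Theory.
Local Open Scope ring_scope.

(** Three choices shape the argument. The norm supplies T_(e^-1), while transport of structure needs
    the inverse of T_e; the two differ, and the difference disappears only after projection to H_L.
    The projections are controlled by the coordinate at 1, a symmetric trace pairing T_w with
    T_(w^-1): it makes them linear on both sides and gives dual bases of H_L over H_J, so norms from
    two conjugate parabolics are compared without any length analysis of the coset representatives.
    Finally, the formula is proved free of denominators over an arbitrary nonzero commutative ring,
    with the order of the centraliser of a Coxeter element in place of |S_n|/|C_alpha|; division
    happens only at the end, over the rationals. *)

(** * Parabolic subgroups, minimal representatives and blocks *)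

Section Parabolic.

Variable n : nat.
Implicit Types (i j : 'I_n.-1) (x y : 'I_n) (w u v d e g : 'S_n).
Implicit Types (J K L M : {set 'I_n.-1}).

(* [blk J] numbers the blocks of consecutive points joined by indices in J. *)
Definition blk J x : nat := #|[set i | (i \notin J) && (i < x)%N]|.

Lemma blk_mono J x y : (x <= y)%N -> (blk J x <= blk J y)%N.
Proof.
move=> lexy; apply/subset_leq_card/subsetP=> i; rewrite !inE => /andP[-> /=].
by move/leq_trans; apply.
Qed.

Lemma blk_lt J i x y :
  i \notin J -> (x <= i)%N -> (i < y)%N -> (blk J x < blk J y)%N.
Proof.
move=> iJ lexi ltiy; apply/proper_card/properP; split.
  apply/subsetP=> k; rewrite !inE => /andP[-> /=] /leq_trans; apply.
  exact: leq_trans lexi (ltnW ltiy).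
by exists i; rewrite !inE iJ //= -leqNgt.
Qed.

Lemma blk_eq J i x y :
  blk J x = blk J y -> (x <= i)%N -> (i < y)%N -> i \in J.
Proof.
move=> exy lexi ltiy; apply: contraT => iJ.
by have := blk_lt iJ lexi ltiy; rewrite exy ltnn.
Qed.

Lemma blk_hi J i : i \in J -> blk J (ord_hi i) = blk J (ord_lo i).
Proof.
move=> iJ; congr #|pred_of_set _|; apply/setP=> k; rewrite !inE /= ltnS leq_eqVlt.
by case: eqVneq => [/ord_inj->|]; rewrite ?iJ.
Qed.

Lemma blk_setD1 J i x : i \in J -> blk (J :\ i) x = (blk J x + (i < x))%N.
Proof.
move=> iJ; rewrite /blk -[X in (_ + X)%N](_ : #|[set j | (j == i) && (i < x)%N]| = _).
  rewrite -cardsUI (_ : _ :&: _ = set0) ?cards0 ?addn0; last first.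
    by apply/setP=> j; rewrite !inE; case: eqVneq => [->|]; rewrite ?iJ ?andbF.
  congr #|pred_of_set _|; apply/setP=> j; rewrite !inE negb_and negbK.
  by case: eqVneq => [->|] /=; rewrite ?iJ ?orbF.
rewrite (_ : [set _ | _] = if (i < x)%N then [set i] else set0).
  by case: ifP; rewrite ?cards1 ?cards0.
by apply/setP=> j; case: ifP; rewrite !inE ?andbT ?andbF.
Qed.

Lemma ord_lo_ex x y : (x < y)%N -> exists i, ord_lo i = x.
Proof.
move=> ltxy; have lt : (x < n.-1)%N by have := ltn_ord y; lia.
by exists (Ordinal lt); apply: val_inj.
Qed.

Lemma ord_hi_ex x y : (x < y)%N -> exists i, ord_hi i = y.
Proof.
move=> ltxy; have lt : (y.-1 < n.-1)%N by have := ltn_ord y; lia.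
by exists (Ordinal lt); apply: val_inj => /=; lia.
Qed.

Lemma blk_sub J K x y : K \subset J -> blk K x = blk K y -> blk J x = blk J y.
Proof.
move=> sKJ; wlog lexy : x y / (x <= y)%N => [th|].
  by case: (leqP x y) => [/th//|/ltnW/th h /esym/h].
move=> exy; apply/eqP; rewrite eqn_leq blk_mono //.
apply/subset_leq_card/subsetP=> i; rewrite !inE => /andP[iJ ltiy].
rewrite iJ /= ltnNge; apply: contra iJ => lexi.
exact: (subsetP sKJ) (blk_eq exy lexi ltiy).
Qed.

(** Preserving blocks replaces generation by reflections, so that membership is a pointwise test;
    [parab_gen] shows that the subgroup is the generated one. *)
Definition parab J : {set 'S_n} :=
  [set w : 'S_n | [forall x, blk J (w x) == blk J x]].

Lemma parabP J w : reflect (forall x, blk J (w x) = blk J x) (w \in parab J).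
Proof. by rewrite inE; apply: 'forall_eqP. Qed.

Lemma parab_group_set J : group_set (parab J).
Proof.
apply/group_setP; split; first by apply/parabP=> x; rewrite perm1.
by move=> u v /parabP uJ /parabP vJ; apply/parabP=> x; rewrite permM vJ.
Qed.
Canonical parab_groupType J := group (parab_group_set J).

Lemma sref_parab J i : i \in J -> sref i \in parab J.
Proof.
move=> iJ; apply/parabP=> x; rewrite /sref.
by case: tpermP => [->|->|//]; rewrite blk_hi.
Qed.

Lemma parab_sub J K : K \subset J -> parab K \subset parab J.
Proof.
move=> sKJ; apply/subsetP=> w /parabP wK; apply/parabP=> x.
exact: blk_sub (wK x).
Qed.

Lemma parab_ldesc J i w : w \in parab J -> ldesc i w -> i \in J.
Proof.
move=> /parabP wJ; rewrite ldescE; apply: contraTT => iJ.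
rewrite -leqNgt; apply: contraT; rewrite -ltnNge => /ltnW/(blk_mono J).
by rewrite !wJ leqNgt (blk_lt iJ) //=.
Qed.

(** A nontrivial element has a left descent, which lies in J by [parab_ldesc]; removing it lowers
    the length and stays in the parabolic. *)
Lemma parab_ind J (P : 'S_n -> Prop) : P 1%g ->
    (forall i w, i \in J -> w \in parab J -> ~~ ldesc i w -> P w ->
       P (sref i * w)%g) ->
  forall w, w \in parab J -> P w.
Proof.
move=> P1 Ps w; have [k] := ubnP (ell w); elim: k w => // k IHk w.
have [->//|/ex_desc[i]] := eqVneq w 1%g; rewrite -ldescE ltnS => di lewk wJ.
have iJ := parab_ldesc wJ di; rewrite -(srefKl i w).
have swJ : (sref i * w)%g \in parab J by rewrite groupM ?sref_parab.
apply: Ps; rewrite ?ldesc_srefl ?di //; apply: IHk => //.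
exact: leq_trans di lewk.
Qed.

Lemma parab_gen J : parab J = <<[set sref i | i in J]>>%g.
Proof.
apply/eqP; rewrite eqEsubset; apply/andP; split; last first.
  by rewrite gen_subG; apply/subsetP=> _ /imsetP[i iJ ->]; apply: sref_parab.
apply/subsetP; apply: parab_ind => [|i w iJ _ _ wJ]; first exact: group1.
by rewrite groupM // mem_gen // imset_f.
Qed.

Lemma parabT : parab setT = setT.
Proof.
apply/setP=> w; rewrite in_setT; apply/parabP=> x.
by rewrite /blk !eq_card0 // => i; rewrite !inE.
Qed.

Lemma parab_fix_gt J w x : w \in parab J ->
  (forall k, k \in J -> (k.+1 < x)%N) -> w x = x.
Proof.
have key v y : v \in parab J -> (forall k, k \in J -> (k.+1 < y)%N) ->
    (v y < y)%N -> False.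
  move=> /parabP vJ gty lt; have [k ky] := ord_hi_ex lt.
  have ky' : k.+1 = y by rewrite -ky.
  have kJ : k \in J by apply: (blk_eq (vJ y)); lia.
  by have := gty k kJ; lia.
move=> wJ gtx; case: (ltngtP (w x) x) => [/(key _ _ wJ gtx)//|lt|/ord_inj//].
case: (key w^-1%g (w x)); rewrite ?groupV ?permK //.
by move=> k /gtx h; apply: ltn_trans h lt.
Qed.

Definition mrep J : {set 'S_n} := [set d | [forall i in J, ~~ ldesc i d]].

Lemma mrep_asc J d i : d \in mrep J -> i \in J -> ~~ ldesc i d.
Proof. by rewrite inE => /forall_inP; apply. Qed.

(** The ascents at the indices of J between x and y chain together, so minimality becomes
    monotonicity on each block. *)
Lemma mrepP J d :
  reflect (forall x y, (x < y)%N -> blk J x = blk J y -> (d x < d y)%N)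
          (d \in mrep J).
Proof.
apply: (iffP idP) => [dJ x y|inc]; last first.
  rewrite inE; apply/forall_inP=> i iJ; rewrite ldescE -leqNgt ltnW //.
  by rewrite inc ?blk_hi //=.
have [k] := ubnP (y - x); elim: k x => // k IHk x ltk ltxy exy.
have [i ix] := ord_lo_ex ltxy; have xi : x = i :> nat by rewrite -ix.
have iJ : i \in J by apply: (blk_eq exy); rewrite -xi.
have lt1 : (d x < d (ord_hi i))%N.
  have := mrep_asc dJ iJ; rewrite ldescE -leqNgt ix => le.
  rewrite ltn_neqAle le andbT val_eqE (inj_eq perm_inj) -ix.
  exact: lo_neq_hi.
move: (ltxy); rewrite leq_eqVlt => /predU1P[e|lt].
  by rewrite (_ : y = ord_hi i) //; apply: val_inj; rewrite /= -xi e.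
apply: (ltn_trans lt1); apply: IHk; rewrite ?blk_hi ?ix //= -xi //; lia.
Qed.

Lemma mrep_ldesc J u d i : u \in parab J -> d \in mrep J -> i \in J ->
  ldesc i (u * d)%g = ldesc i u.
Proof.
move=> /parabP uJ /mrepP dJ iJ; rewrite !ldescE !permM.
have E : blk J (u (ord_lo i)) = blk J (u (ord_hi i)) by rewrite !uJ blk_hi.
case: (ltngtP (u (ord_hi i)) (u (ord_lo i))) => [lt|lt|/ord_inj->].
- by rewrite dJ.
- by apply/negbTE; rewrite -leqNgt ltnW // dJ.
- by rewrite ltnn.
Qed.

Lemma ell_parabM J u d : u \in parab J -> d \in mrep J ->
  ell (u * d)%g = (ell u + ell d)%N.
Proof.
move=> + dJ; move: u; apply: parab_ind => [|i w iJ wJ ai IH].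
  by rewrite mul1g ell1.
by rewrite -mulgA !ell_srefl (mrep_ldesc wJ dJ iJ) (negbTE ai) IH.
Qed.

Lemma min_repsE (G : {set 'S_n}) K : min_reps G (parab K) = G :&: mrep K.
Proof.
apply/setP=> d; rewrite in_setI [LHS]inE; apply: andb_id2l => _.
apply/forall_inP/idP => [dmin|dK u uK]; last first.
  by rewrite (ell_parabM uK dK) leq_addl.
rewrite inE; apply/forall_inP=> i iK; rewrite /ldesc -leqNgt.
exact: dmin (sref_parab iK).
Qed.

Lemma parab_decomp J w : exists u d,
  [/\ u \in parab J, d \in mrep J & w = (u * d)%g].
Proof.
have [k] := ubnP (ell w); elim: k w => // k IHk w; rewrite ltnS => lewk.
have [wJ|] := boolP (w \in mrep J); first by exists 1%g, w; rewrite mul1g group1.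
rewrite inE => /forall_inPn[i iJ]; rewrite negbK => di.
have [|u [d [uJ dJ E]]] := IHk (sref i * w)%g; first exact: leq_trans di lewk.
exists (sref i * u)%g, d; rewrite groupM ?sref_parab //; split=> //.
by rewrite -mulgA -E srefKl.
Qed.

Lemma parab_decomp_uniq J u u' d d' : u \in parab J -> u' \in parab J ->
  d \in mrep J -> d' \in mrep J -> (u * d = u' * d')%g -> u = u' /\ d = d'.
Proof.
move=> uJ u'J dJ d'J E.
have vJ : (u'^-1 * u)%g \in parab J by rewrite groupM ?groupV.
have dE : d' = (u'^-1 * u * d)%g by rewrite -mulgA E mulKg.
have dE' : d = ((u'^-1 * u)^-1 * d')%g by rewrite dE mulKg.
have v0 : ell (u'^-1 * u)%g = 0%N.
  have := ell_parabM vJ dJ; rewrite -dE.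
  by have := ell_parabM (groupVr vJ) d'J; rewrite -dE'; lia.
have v1 := ell_eq0 v0; rewrite v1 mul1g in dE; split=> //.
by rewrite -[u](mulKVg u') v1 mulg1.
Qed.

Lemma sum_parab_l (V : nmodType) J L (F : 'S_n -> V) : J \subset L ->
  \sum_(g in parab L) F g =
    \sum_(d in parab L :&: mrep J) \sum_(u in parab J) F (u * d)%g.
Proof.
move=> sJL; have sW := subsetP (parab_sub sJL).
pose f (p : 'S_n * 'S_n) := (p.2 * p.1)%g.
have -> : \sum_(g in parab L) F g =
    \sum_(g in f @: setX (parab L :&: mrep J) (parab J)) F g.
  apply: eq_bigl => g; apply/idP/imsetP => [gL|[[d u] /setXP[]]]; last first.
    rewrite in_setI => /andP[dL _] uJ ->.
    by apply: groupM; [exact: sW | exact: dL].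
  have [u [d [uJ dJ E]]] := parab_decomp J g; exists (d, u) => //.
  rewrite in_setX /= uJ in_setI dJ !andbT.
  by rewrite -(groupMl _ (sW _ uJ)) -E gL.
rewrite big_imset /=; last first.
  move=> [d u] [d' u'] /setXP[/setIP[_ dJ] uJ] /setXP[/setIP[_ d'J] u'J].
  by case/(parab_decomp_uniq uJ u'J dJ d'J) => /= -> ->.
by rewrite pair_big; apply: eq_bigl => -[d u]; rewrite in_setX.
Qed.

End Parabolic.

(** * Coxeter elements and conjugations matching simple reflections *)

Section Coxeter.

Variable n : nat.
Implicit Types (i j k : 'I_n.-1) (x y : 'I_n) (w u v d e g : 'S_n).
Implicit Types (J K L M : {set 'I_n.-1}).

Lemma sum_parab_r (V : nmodType) J L (F : 'S_n -> V) : J \subset L ->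
  \sum_(g in parab L) F g =
    \sum_(e in parab L | e^-1%g \in mrep J) \sum_(v in parab J) F (e * v)%g.
Proof.
move=> sJL; rewrite (reindex_inj invg_inj) /=.
under eq_bigl do rewrite groupV.
rewrite (sum_parab_l (fun g => F g^-1%g) sJL) (reindex_inj invg_inj) /=.
apply: eq_big => [d|d _]; first by rewrite in_setI groupV.
rewrite (reindex_inj invg_inj) /=; apply: eq_big => [v|v _].
  by rewrite groupV.
by rewrite invMg !invgK.
Qed.

Lemma enum_sorted J : sorted (fun i j => (i < j)%N) (enum J).
Proof.
rewrite /enum_mem; apply: sorted_filter.
  by move=> i j k; apply: ltn_trans.
by have := iota_ltn_sorted 0 n.-1; rewrite -val_enum_ord sorted_map enumT.
Qed.

Definition cox J : 'S_n := wprod (enum J).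

Lemma wprod_fix (s : seq 'I_n.-1) x :
  (forall j, j \in s -> (x < j)%N) -> wprod s x = x.
Proof.
elim: s => [|j s IHs] lts; first by rewrite wprod_nil perm1.
rewrite wprod_cons permM (_ : sref j x = x) ?IHs // => [k ks|].
  by apply: lts; rewrite inE ks orbT.
have ltj := lts j (mem_head _ _).
by apply: ord_inj; rewrite srefP !ltn_eqF // ltnW.
Qed.

(** Products act from left to right with increasing indices: factors below i fix i+1, s_i lowers it
    to i, and factors above i fix i. *)
Lemma cox_hi J i : i \in J -> cox J (ord_hi i) = ord_lo i.
Proof.
rewrite -mem_enum /cox; have := enum_sorted J; elim: (enum J) => // j s IHs.
rewrite [sorted _ _]/= path_sortedE; last by move=> ? ? ?; apply: ltn_trans.
move=> /andP[/allP ltj /IHs{}IHs]; rewrite wprod_cons permM inE.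
case: eqP => [-> _|_ /= iS].
  by rewrite sref_hi wprod_fix.
rewrite (_ : sref j _ = ord_hi i) ?IHs //; apply: ord_inj; rewrite srefP /=.
by have := ltj i iS => lt; rewrite eqSS !gtn_eqF // ltnW.
Qed.

Lemma cox_parab J : cox J \in parab J.
Proof.
have : {subset enum J <= J} by move=> i; rewrite mem_enum.
rewrite /cox; elim: (enum J) => [|i s IHs] sJ.
  by rewrite wprod_nil group1.
rewrite wprod_cons groupM //; first by apply/sref_parab/sJ/mem_head.
by apply: IHs => j js; apply: sJ; rewrite inE js orbT.
Qed.

(** The quotient v fixes every point of a block except perhaps the last, and it preserves the block,
    so it fixes that one too. This recognises conjugates of Coxeter elements. *)
Lemma cox_uniq J w :
  w \in parab J -> (forall i, i \in J -> w (ord_hi i) = ord_lo i) -> w = cox J.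
Proof.
move=> wJ wlo; pose v := (w^-1 * cox J)%g.
have vJ : v \in parab J by rewrite groupM ?groupV ?cox_parab.
have vlo i : i \in J -> v (ord_lo i) = ord_lo i.
  by move=> iJ; rewrite permM -(wlo i iJ) permK cox_hi ?wlo.
suff v1 : v = 1%g by rewrite -[w]mulg1 -v1 mulKVg.
apply/permP=> x; rewrite perm1; apply/eqP; apply: contraT => nvx.
have bx : blk J (v x) = blk J x by apply/parabP.
case: (ltngtP x (v x)) => [lt|lt|/ord_inj e]; last by rewrite -e eqxx in nvx.
  have [i ix] := ord_lo_ex lt; rewrite -ix vlo ?eqxx // in nvx.
  by apply: (blk_eq (esym bx)); rewrite -[nat_of_ord i]/(ord_lo i : nat) ix.
have [i ix] := ord_lo_ex lt.
have iJ : i \in J.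
  by apply: (blk_eq bx); rewrite -[nat_of_ord i]/(ord_lo i : nat) ix.
by have := vlo i iJ; rewrite ix => /perm_inj e; rewrite e eqxx in nvx.
Qed.

(** The last index of each run of J is dropped; on index sets of compositions this is the passage
    from lam to lam-1 ([pset_minus1]). *)
Definition prec J : {set 'I_n.-1} :=
  [set i in J | [exists j in J, j == i.+1 :> nat]].

Lemma prec_sub J : prec J \subset J.
Proof. by apply/subsetP=> i; rewrite inE => /andP[]. Qed.

(** Matching the pairs with their orientation makes e increasing on the blocks of J and e^-1 on
    those of K, so that lengths add on both sides. *)
Definition transports e J K : Prop :=
  (forall i, i \in J -> exists2 k, k \in K &
     e (ord_lo i) = ord_lo k /\ e (ord_hi i) = ord_hi k) /\
  (forall k, k \in K -> exists2 i, i \in J &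
     e (ord_lo i) = ord_lo k /\ e (ord_hi i) = ord_hi k).

Lemma transportsV e J K : transports e J K -> transports e^-1%g K J.
Proof.
case=> eJ eK; split=> [k /eK[i iJ [<- <-]]|i /eJ[k kK [e1 e2]]].
  by exists i; rewrite ?permK.
by exists k; rewrite // -e1 -e2 !permK.
Qed.

Lemma transports_mrep e J K : transports e J K -> e \in mrep J.
Proof.
case=> eJ _; rewrite inE; apply/forall_inP=> i /eJ[k _ [e1 e2]].
by rewrite ldescE e1 e2 -leqNgt /=.
Qed.

Lemma transports_parab e J K w :
  transports e J K -> w \in parab J -> (w ^ e)%g \in parab K.
Proof.
case=> eJ _; move: w; apply: parab_ind => [|i w iJ wJ _ IH].
  by rewrite conj1g group1.
have [k kK [e1 e2]] := eJ i iJ.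
by rewrite conjMg groupM // tpermJ e1 e2 sref_parab.
Qed.

Lemma transports_cox e J K : transports e J K -> (cox J ^ e)%g = cox K.
Proof.
move=> eJK; apply: cox_uniq; first exact: transports_parab eJK (cox_parab J).
move=> k /(proj2 eJK)[i iJ [<- <-]].
by rewrite permJ cox_hi.
Qed.

Lemma ord_lo_succ i j : j = i.+1 :> nat -> ord_lo j = ord_hi i.
Proof. by move=> e; apply: val_inj. Qed.

Lemma ord_lo_inj : injective (@ord_lo n).
Proof. by move=> i j /(congr1 val) /= /ord_inj. Qed.

Lemma transports_prec e J K : transports e J K -> transports e (prec J) (prec K).
Proof.
have half e' J' K' : transports e' J' K' -> forall i, i \in prec J' ->
   exists2 k, k \in prec K' & e' (ord_lo i) = ord_lo k /\ e' (ord_hi i) = ord_hi k.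
  case=> eJ _ i; rewrite inE => /andP[/eJ[k kK [e1 e2]]].
  case/exists_inP=> j jJ /eqP/ord_lo_succ ij; exists k => //.
  rewrite inE kK /=; have [l lK [e3 _]] := eJ j jJ; apply/exists_inP.
  by exists l => //; move: e3; rewrite ij e2 => /(congr1 val) /= <-.
move=> eJK; split; first exact: half eJK.
move=> k /(half _ _ _ (transportsV eJK))[i iJ [e1 e2]].
by exists i; rewrite // -e1 -e2 !permKV.
Qed.

(** Minimality for J puts the image of i below that of i+1; minimality for L makes the two adjacent,
    since a point strictly between them, being in the same L-block, would come from a point strictly
    between i and i+1. *)
Lemma transports_ex e J L : e \in mrep J -> e^-1%g \in mrep L ->
    (forall i, i \in J -> blk L (e (ord_lo i)) = blk L (e (ord_hi i))) ->
  exists2 K : {set _}, K \subset L & transports e J K.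
Proof.
move=> /mrepP eJ /mrepP eL bJ.
have key i : i \in J -> exists2 k, k \in L &
    e (ord_lo i) = ord_lo k /\ e (ord_hi i) = ord_hi k.
  move=> iJ; have lt : (e (ord_lo i) < e (ord_hi i))%N by rewrite eJ ?blk_hi /=.
  have [k kE] := ord_lo_ex lt; have kL : k \in L.
    by apply: (blk_eq (bJ i iJ)); rewrite -[nat_of_ord k]/(ord_lo k : nat) kE.
  exists k; rewrite // kE; split=> //; apply/eqP.
  have le : (ord_hi k <= e (ord_hi i))%N by have := lt; rewrite -kE.
  rewrite -val_eqE eqn_leq le andbT leqNgt; apply/negP=> lt2.
  have b1 : blk L (ord_hi k) = blk L (e (ord_hi i)).
    by rewrite blk_hi // kE bJ.
  have b2 : blk L (e (ord_lo i)) = blk L (ord_hi k) by rewrite b1 bJ.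
  have := eL _ _ lt2 b1; have := eL (e (ord_lo i)) (ord_hi k) _ b2.
  by rewrite !permK -{1}kE /= => /(_ (ltnSn _)); lia.
exists [set k | [exists i in J, (e (ord_lo i) == ord_lo k) &&
                                (e (ord_hi i) == ord_hi k)]].
  apply/subsetP=> k; rewrite inE => /exists_inP[i /key[k' k'L [e1 _]] /andP[]].
  by rewrite e1 => /eqP/ord_lo_inj<-.
split=> [i iJ|k]; last first.
  by rewrite inE => /exists_inP[i iJ /andP[/eqP ? /eqP ?]]; exists i.
have [k kL [e1 e2]] := key i iJ; exists k => //; rewrite inE.
by apply/exists_inP; exists i; rewrite ?e1 ?e2 ?eqxx.
Qed.

Lemma cox_conj_blk e J L : (cox J ^ e)%g \in parab L ->
  forall i, i \in J -> blk L (e (ord_lo i)) = blk L (e (ord_hi i)).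
Proof.
move=> /parabP eL i iJ.
by have := eL (e (ord_hi i)); rewrite permJ cox_hi.
Qed.

Lemma blk_const (T : Type) J (f : 'I_n -> T) :
    (forall i, i \in J -> f (ord_lo i) = f (ord_hi i)) ->
  forall x y, blk J x = blk J y -> f x = f y.
Proof.
move=> fJ x y; wlog lexy : x y / (x <= y)%N => [th|].
  by case: (leqP x y) => [/th//|/ltnW/th h /esym/h].
have [k] := ubnP (y - x); elim: k x lexy => // k IHk x.
rewrite leq_eqVlt => /predU1P[/ord_inj-> //|ltxy] ltk exy.
have [i ix] := ord_lo_ex ltxy; have xi : x = i :> nat by rewrite -ix.
have iJ : i \in J by apply: (blk_eq exy); rewrite -xi.
rewrite -{1}ix fJ //; apply: IHk; rewrite ?blk_hi ?ix //= -?xi //; lia.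
Qed.

(** Minimality of e for J is automatic here: each J-block is sent into one L-block, where an
    inversion of e would contradict the monotonicity of e^-1. *)
Lemma cox_conj_transports e J L : e^-1%g \in mrep L ->
  (cox J ^ e)%g \in parab L -> exists2 K : {set _}, K \subset L & transports e J K.
Proof.
move=> eL /cox_conj_blk bJ; apply: transports_ex => //; apply/mrepP=> x y ltxy.
move=> /(@blk_const _ _ (fun z => blk L (e z)) bJ) b; rewrite ltnNge; apply/negP.
rewrite leq_eqVlt => /predU1P[/ord_inj/perm_inj e1|lt].
  by rewrite e1 ltnn in ltxy.
have := mrepP _ _ eL _ _ lt (esym b); rewrite !permK => lt2.
by have := ltn_trans ltxy lt2; rewrite ltnn.
Qed.

(** The L-block of [e x] is a w-invariant function of x, weakly increasing on each J-block. If it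
    jumped at i, then w would preserve the part of the block beyond i and would lie in
    [parab (J :\ i)]. *)
Lemma full_conj_blk e J L w : e \in mrep J -> w \in parab J ->
    (forall i, i \in J -> w \notin parab (J :\ i)) -> (w ^ e)%g \in parab L ->
  forall i, i \in J -> blk L (e (ord_lo i)) = blk L (e (ord_hi i)).
Proof.
move=> /mrepP eJ /parabP wJ full /parabP weL i iJ.
pose f x := blk L (e x); have fw x : f (w x) = f x.
  by rewrite /f -(weL (e x)) permJ.
have mono x y : (x <= y)%N -> blk J x = blk J y -> (f x <= f y)%N.
  rewrite leq_eqVlt => /predU1P[/ord_inj->//|lt b].
  exact/blk_mono/ltnW/eJ.
apply: contraNeq (full i iJ) => neq.
have ltf : (f (ord_lo i) < f (ord_hi i))%N.
  by rewrite ltn_neqAle neq mono ?blk_hi //=.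
have cut x : blk J x = blk J (ord_lo i) ->
    (i < x)%N = (f (ord_lo i) < f x)%N.
  move=> bx; have bx' : blk J (ord_hi i) = blk J x by rewrite blk_hi.
  case: ltnP => [lt|le]; last by apply/esym/negbTE; rewrite -leqNgt mono.
  by rewrite (leq_trans ltf) // mono.
have side x : (i < w x)%N = (i < x)%N.
  have [b|nb] := eqVneq (blk J x) (blk J (ord_lo i)).
    by rewrite !cut ?fw ?wJ.
  have out y : blk J y != blk J (ord_lo i) ->
      (i < y)%N = (blk J (ord_lo i) < blk J y)%N.
    move=> nby; case: ltnP => [lt|le]; last first.
      by apply/esym/negbTE; rewrite -leqNgt blk_mono.
    by rewrite ltn_neqAle eq_sym nby -(blk_hi iJ) blk_mono.
  by rewrite !out ?wJ.
by apply/parabP=> x; rewrite !blk_setD1 // wJ side.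
Qed.

End Coxeter.

(** * Trace form, projections and dual bases *)

Section ParabolicSubalgebra.

Variables (R : comNzRingType) (xi : R) (n : nat).
Local Notation H := (hecke xi n).
Local Notation T := (@hT R xi n).
Implicit Types (i j k : 'I_n.-1) (w u v d e g : 'S_n) (h f x y z : H).
Implicit Types (J K L M : {set 'I_n.-1}).

Lemma ellM_le u v : (ell (u * v)%g <= ell u + ell v)%N.
Proof.
have := ell_wprod (redword u ++ redword v).
by rewrite size_cat !size_tuple /wprod big_cat /= -!/(wprod _) !wprod_redword.
Qed.

(** Additivity forces each left descent i of u to be one of [u * v], since s_i u v has length at
    most l(s_i u) + l(v); it can then be removed from both sides. *)
Lemma hTM u v : ell (u * v)%g = (ell u + ell v)%N -> T (u * v)%g = T u * T v.
Proof.
have [k] := ubnP (ell u); elim: k u => // k IHk u; rewrite ltnS => leuk euv.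
have [->|/ex_desc[i]] := eqVneq u 1%g; first by rewrite !mul1g mul1r.
rewrite -ldescE => di; have e0 : ell (sref i * u)%g = (ell u).-1.
  by rewrite ell_srefl di.
have ugt0 : (0 < ell u)%N by apply: leq_ltn_trans di.
have asc w : ldesc i w -> T w = hgen xi i * T (sref i * w)%g.
  by move=> dw; rewrite hgen_asc ?srefKl // ldesc_srefl dw.
have e1 : (ell (sref i * (u * v))%g <= (ell u).-1 + ell v)%N.
  by rewrite mulgA -e0 ellM_le.
have := ell_srefl i (u * v)%g; case: ifP => [duv e2|_ e2]; last by exfalso; lia.
have e3 : ell (sref i * u * v)%g = (ell (sref i * u)%g + ell v)%N.
  by rewrite -mulgA e2 e0 euv; lia.
by rewrite (asc _ duv) mulgA (IHk _ _ e3) ?mulrA -?asc //; lia.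
Qed.

Lemma hT_parabM J u d : u \in parab J -> d \in mrep J -> T (u * d)%g = T u * T d.
Proof. by move=> uJ dJ; apply/hTM/(ell_parabM uJ dJ). Qed.

Lemma hT_Mparab J e v :
  e^-1%g \in mrep J -> v \in parab J -> T (e * v)%g = T e * T v.
Proof.
move=> eJ vJ; apply: hTM.
by rewrite -ellV invMg (ell_parabM _ eJ) ?groupV // !ellV addnC.
Qed.

Lemma hT_Msref w i : ~~ ldesc i w^-1%g -> T (w * sref i)%g = T w * hgen xi i.
Proof.
move=> ai; apply: (@hT_Mparab [set i]); last by rewrite sref_parab ?inE.
by rewrite inE; apply/forall_inP=> j; rewrite inE => /eqP->.
Qed.

Lemma hT_invertible w : exists y, y * T w = 1 /\ T w * y = 1.
Proof.
have: w \in parab setT by rewrite parabT inE.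
move: w; apply: (@parab_ind n setT) => [|i w _ _ ai [y [yw wy]]].
  by exists 1; rewrite hT1 mulr1.
have [_ _ sq] := hgen_rel xi n; have gg := sq i.
exists (y * (hgen xi i - xi%:A)); rewrite -hgen_asc // -mulrA.
have c : (hgen xi i - xi%:A) * hgen xi i = 1.
  by rewrite mulrBl -expr2 gg -scalerAl mul1r addrK.
have c' : hgen xi i * (hgen xi i - xi%:A) = 1.
  by rewrite mulrBr -expr2 gg -scalerAr mulr1 addrK.
split; first by rewrite [_ * (hgen xi i * _)]mulrA c mul1r yw.
by rewrite -mulrA [T w * _]mulrA wy mul1r c'.
Qed.

Lemma hcoordTM w x : hcoord (T w^-1%g * x) 1%g = hcoord x w.
Proof.
have: w \in parab setT by rewrite parabT inE.
move=> wT; move: w wT x; apply: parab_ind => [|i w _ _ ai IH] x; first by rewrite invg1 mul1r.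
have -> : T (sref i * w)^-1%g = T w^-1%g * hgen xi i.
  by rewrite invMg srefV hT_Msref ?invgK.
by rewrite -mulrA IH hgenM lop_coord (negbTE ai) addr0.
Qed.

Lemma hcoordTT u v : hcoord (T u * T v) 1%g = (v == u^-1%g)%:R.
Proof. by rewrite -{1}[u]invgK hcoordTM hcoordT eq_sym. Qed.

(** By [hcoordTT] the coordinate at 1 pairs T_u with T_(u^-1) only, and this condition is
    symmetric. *)
Lemma htauC x y : hcoord (x * y) 1%g = hcoord (y * x) 1%g.
Proof.
rewrite {2}(hexp x) {1}(hexp x) mulr_suml mulr_sumr !hcoord_sum.
apply: eq_bigr => w _; rewrite -scalerAl -scalerAr !hcoordZ; congr (_ * _).
rewrite (hexp y) mulr_suml mulr_sumr !hcoord_sum.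
apply: eq_bigr => v _; rewrite -scalerAl -scalerAr !hcoordZ !hcoordTT.
by rewrite -(inj_eq invg_inj v) invgK eq_sym.
Qed.

Definition pj J h : H := \sum_(w in parab J) hcoord h w *: T w.

Lemma pj_is_linear J : linear (pj J).
Proof.
move=> a x y; rewrite /pj scaler_sumr -big_split; apply: eq_bigr => w _ /=.
by rewrite hcoordD hcoordZ scalerDl scalerA.
Qed.
HB.instance Definition _ J :=
  GRing.isLinear.Build R H H _ (pj J) (pj_is_linear J).

Lemma hcoord_pj J h w :
  hcoord (pj J h) w = if w \in parab J then hcoord h w else 0.
Proof.
rewrite hcoord_sum; case: ifP => [wJ|wJ].
  rewrite (bigD1 w) //= hcoordZ hcoordT eqxx mulr1 big1 ?addr0 // => v /andP[_ nvw].
  by rewrite hcoordZ hcoordT eq_sym (negbTE nvw) mulr0.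
apply: big1 => v vJ; rewrite hcoordZ hcoordT; case: eqP => [e|]; rewrite ?mulr0 //.
by rewrite e vJ in wJ.
Qed.

Lemma pjT J w : w \in parab J -> pj J (T w) = T w.
Proof.
move=> wJ; apply: hcoordP => v; rewrite hcoord_pj hcoordT.
by case: eqP => [->|_]; rewrite ?wJ ?if_same.
Qed.

Lemma pjK J h : pj J (pj J h) = pj J h.
Proof. by apply: hcoordP => w; rewrite !hcoord_pj; case: (_ \in _). Qed.

Lemma pj_Tl J u h : u \in parab J -> pj J (T u * h) = T u * pj J h.
Proof.
move=> uJ; move: u uJ h; apply: parab_ind => [|i w iJ wJ ai IH] h.
  by rewrite !mul1r.
rewrite -hgen_asc // -!mulrA -IH; move: (_ * h) => {}h.
apply: hcoordP => v; rewrite hcoord_pj !hgenM !lop_coord !hcoord_pj.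
rewrite groupMl ?sref_parab //.
by case: ifP => // _; rewrite mulr0 if_same addr0.
Qed.

Lemma pj_Ml J x h : pj J x = x -> pj J (x * h) = x * pj J h.
Proof.
move=> <-; rewrite /pj -!/(pj J _) !mulr_suml linear_sum; apply: eq_bigr => w wJ.
by rewrite -!scalerAl linearZ /= pj_Tl.
Qed.

(** The trace form is nondegenerate on H_J: pairing with T_(w^-1) reads off the coordinate at w.
    Identities between projections are proved by this test. *)
Lemma pj_eq J x y : pj J x = x -> pj J y = y ->
  (forall u, u \in parab J -> hcoord (T u * x) 1%g = hcoord (T u * y) 1%g) ->
  x = y.
Proof.
move=> <- <- e; apply: hcoordP => w; rewrite !hcoord_pj; case: ifP => // wJ.
have := e w^-1%g; rewrite groupV => /(_ wJ); rewrite !hcoordTM !hcoord_pj.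
by rewrite wJ.
Qed.

Lemma htau_pj J h : hcoord (pj J h) 1%g = hcoord h 1%g.
Proof. by rewrite hcoord_pj group1. Qed.

(** Symmetry of the trace turns linearity on the left into linearity on the right. *)
Lemma pj_Mr J x h : pj J x = x -> pj J (h * x) = pj J h * x.
Proof.
move=> xJ; apply: (@pj_eq J); rewrite ?pjK //.
  by rewrite pj_Ml ?pjK // xJ.
move=> u uJ; rewrite -pj_Tl // htau_pj [in RHS]mulrA -[in RHS]pj_Tl //.
by rewrite [RHS]htauC -pj_Ml // htau_pj [RHS]htauC mulrA.
Qed.

(** Pairing with T_u asks whether u d = d', and uniqueness of the coset decomposition leaves u = 1,
    d = d'. Thus T_d and T_(d^-1) form dual bases over H_J. *)
Lemma pj_dual J d d' : d \in mrep J -> d' \in mrep J ->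
  pj J (T d * T d'^-1%g) = (d == d')%:R.
Proof.
move=> dJ d'J; apply: (@pj_eq J); rewrite ?pjK //.
  by rewrite linearMn /= -(hT1 xi n) pjT.
move=> u uJ; rewrite -pj_Tl // htau_pj mulrA -(hT_parabM uJ dJ) hcoordTT.
rewrite (inj_eq invg_inj).
have [<-|nd] := eqVneq d d'.
  by rewrite mulr1 hcoordT -{1}[d]mul1g (inj_eq (mulIg d)).
rewrite mulr0 /hcoord [RHS]ffunE; case: eqP => // e; case/eqP: nd.
have E : (1 * d' = u * d)%g by rewrite mul1g.
by have [_ ->] := parab_decomp_uniq (group1 _) uJ d'J dJ E.
Qed.

Lemma pj_expand_r J L y : J \subset L -> pj L y = y ->
  y = \sum_(d in parab L :&: mrep J) pj J (y * T d^-1%g) * T d.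
Proof.
move=> sJL yL; have E x : y * x = \sum_(w in parab L) hcoord y w *: (T w * x).
  by rewrite -{1}yL mulr_suml; apply: eq_bigr => w _; rewrite scalerAl.
under eq_bigr do rewrite E linear_sum mulr_suml.
rewrite exchange_big /= -[LHS]yL; apply: eq_bigr => w wL.
have [u [d [uJ dJ wE]]] := parab_decomp J w.
have dL : d \in parab L :&: mrep J.
  rewrite in_setI dJ andbT -(groupMl _ (subsetP (parab_sub sJL) _ uJ)) /=.
  by rewrite -wE.
under eq_bigr do rewrite linearZ /= -scalerAl.
rewrite -scaler_sumr; congr (_ *: _); rewrite (bigD1 d) //= big1 => [|d'].
  by rewrite wE (hT_parabM uJ dJ) -mulrA pj_Tl // pj_dual // eqxx mulr1 addr0.
case/andP=> /setIP[_ d'J] nd; rewrite wE (hT_parabM uJ dJ) -mulrA pj_Tl //.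
by rewrite pj_dual // eq_sym (negbTE nd) mulr0 mul0r.
Qed.

Lemma pj_expand_l J L y : J \subset L -> pj L y = y ->
  y = \sum_(d in parab L :&: mrep J) T d^-1%g * pj J (T d * y).
Proof.
move=> sJL yL; have E x : x * y = \sum_(w in parab L) hcoord y w *: (x * T w).
  by rewrite -{1}yL mulr_sumr; apply: eq_bigr => w _; rewrite scalerAr.
under eq_bigr do rewrite E linear_sum mulr_sumr.
rewrite exchange_big /= -[LHS]yL; apply: eq_bigr => w wL.
have [u [d [uJ dJ wE]]] := parab_decomp J w^-1%g.
have dL : d \in parab L :&: mrep J.
  rewrite in_setI dJ andbT -(groupMl _ (subsetP (parab_sub sJL) _ uJ)) /=.
  by rewrite -wE groupV.
have wE' : T w = T d^-1%g * T u^-1%g.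
  by rewrite -[w]invgK wE invMg (@hT_Mparab J) ?invgK ?groupV.
have uK : pj J (T u^-1%g) = T u^-1%g by rewrite pjT ?groupV.
under eq_bigr do rewrite linearZ /= -scalerAr.
rewrite -scaler_sumr; congr (_ *: _); rewrite (bigD1 d) //= big1 => [|d'].
  by rewrite wE' mulrA pj_Mr // pj_dual // eqxx mul1r addr0.
case/andP=> /setIP[_ d'J] nd; rewrite wE' mulrA pj_Mr //.
by rewrite pj_dual // (negbTE nd) mul0r mulr0.
Qed.

Lemma relnormE L J h : relnorm (parab L) (parab J) h =
  \sum_(d in parab L :&: mrep J) T d^-1%g * h * T d.
Proof. by rewrite /relnorm min_repsE. Qed.

(** Both w e and e w^e are length-additive factorisations of the same permutation. *)
Lemma transports_T e J K w : transports e J K -> w \in parab J ->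
  T w * T e = T e * T (w ^ e)%g.
Proof.
move=> eJK wJ; rewrite -(hT_parabM wJ (transports_mrep eJK)).
rewrite conjgC; apply: hT_Mparab (transports_parab eJK wJ).
exact: transports_mrep (transportsV eJK).
Qed.

(** Conjugation by T_e exchanges H_J and H_K and preserves the trace, hence it exchanges the two
    projections. *)
Lemma pj_transport e J K y z : transports e J K -> y * T e = 1 -> T e * y = 1 ->
  pj J z = T e * pj K (y * z * T e) * y.
Proof.
move=> eJK ye ey; apply: (@pj_eq J); rewrite ?pjK //.
  rewrite /pj -!/(pj J _) mulr_sumr mulr_suml linear_sum.
  apply: eq_bigr => w wK; rewrite -scalerAr -scalerAl linearZ /=.
  have wJ := transports_parab (transportsV eJK) wK.
  have := transports_T eJK wJ; rewrite conjgKV => <-.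
  by rewrite -[T _ * T e * y]mulrA ey mulr1 pjT.
move=> u uJ; rewrite -pj_Tl // htau_pj; set p := pj K _.
rewrite -[T e * p * y]mulrA mulrA (transports_T eJK uJ) -!mulrA [RHS]htauC -!mulrA ye mulr1.
have uK := transports_parab eJK uJ; rewrite -pj_Tl // htau_pj.
have -> : T (u ^ e)%g * (y * z * T e) = y * (T u * z) * T e.
  rewrite !mulrA; congr (_ * z * T e).
  rewrite -[LHS]mul1r -{1}ye -!mulrA [T e * (_ * _)]mulrA.
  by rewrite -(transports_T eJK) // -!mulrA ey mulr1.
by rewrite [RHS]htauC mulrA ey mul1r.
Qed.

(* Sums [sum a f b] over dual bases [a], [b] of the extension do not depend on
   the bases when [f] centralises the smaller algebra; here the second pair of
   bases is [T_(d^-1) T_e^-1], [T_e T_d] with [d] in [mrep K]. *)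
Lemma relnorm_transport L J K e y f : J \subset L -> K \subset L ->
    e \in parab L -> transports e J K -> y * T e = 1 -> T e * y = 1 ->
    (forall u, u \in parab J -> f * T u = T u * f) ->
  relnorm (parab L) (parab J) f = relnorm (parab L) (parab K) (y * f * T e).
Proof.
move=> sJL sKL eL eJK ye ey fC; rewrite !relnormE.
have fpj z : f * pj J z = pj J z * f.
  rewrite /pj mulr_sumr mulr_suml; apply: eq_bigr => u uJ.
  by rewrite -scalerAr -scalerAl fC.
have dL d : d \in parab L :&: mrep K -> pj L (T e * T d) = T e * T d.
  by case/setIP=> dL _; rewrite pj_Tl ?pjT.
(* T_e T_d is expanded along [mrep J]; the coefficients lie in H_J, so they pass through f, and
   [pj_transport] moves them to H_K. *)
have E d : d \in parab L :&: mrep K -> T d^-1%g * (y * f * T e) * T d =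
    \sum_(c in parab L :&: mrep J)
      T d^-1%g * pj K (T d * (T c^-1%g * T e)) * (y * f * T c).
  move=> dK; rewrite -mulrA -[y * f * T e * T d]mulrA.
  rewrite (pj_expand_r sJL (dL d dK)) !mulr_sumr; apply: eq_bigr => c _.
  rewrite [y * f * (_ * _)]mulrA -[y * f * pj J _]mulrA fpj.
  rewrite (pj_transport _ eJK ye ey) !mulrA ye mul1r.
  by rewrite -!mulrA [y * (T e * _)]mulrA ye mul1r.
(* With the sums exchanged, the sum over d is the expansion of T_(c^-1) T_e along [mrep K]; T_e then
   cancels against y. *)
rewrite [RHS](eq_bigr _ E) [RHS]exchange_big /=; apply: eq_bigr => c /setIP[cL _].
rewrite -mulr_suml -(pj_expand_l sKL).
  by rewrite -!mulrA [T e * _]mulrA ey mul1r.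
by rewrite pj_Tl ?groupV // pjT.
Qed.

Definition eta J : H :=
  \sum_(d in parab (prec J)) T d^-1%g * T (cox J) * T d.

Lemma pj_eta J : pj J (eta J) = eta J.
Proof.
rewrite /eta linear_sum; apply: eq_bigr => d /(subsetP (parab_sub (prec_sub J))) dJ.
by rewrite /= -mulrA !pj_Tl ?groupV ?cox_parab // pjT.
Qed.

Lemma eta_transport e J K y : transports e J K -> y * T e = 1 ->
  y * eta J * T e = eta K.
Proof.
move=> eJK ye; have eP := transports_prec eJK.
rewrite /eta mulr_sumr mulr_suml [RHS](reindex_inj (conjg_inj e)) /=.
apply: eq_big => [d|d dP].
  apply/idP/idP; first exact: transports_parab.
  by move/(transports_parab (transportsV eP)); rewrite conjgK.
have dJ := subsetP (parab_sub (prec_sub J)) _ dP.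
rewrite -!mulrA (transports_T eJK dJ) [T (cox J) * _]mulrA.
rewrite (transports_T eJK (cox_parab J)) (transports_cox eJK).
rewrite -!mulrA [T d^-1%g * _]mulrA (transports_T eJK) ?groupV //.
by rewrite conjVg -!mulrA mulrA ye mul1r.
Qed.

End ParabolicSubalgebra.

(** * Coset representatives along initial segments of an index set *)

Section Truncation.

Variable n : nat.
Implicit Types (i j k : 'I_n.-1) (x y : 'I_n) (w u v d e g r : 'S_n).
Implicit Types (C J K L M : {set 'I_n.-1}).

Definition trunc C m : {set 'I_n.-1} := [set i in C | (i < m)%N].

Lemma trunc0 C : trunc C 0 = set0.
Proof. by apply/setP=> i; rewrite !inE ltn0 andbF. Qed.

Lemma trunc_notin C m : (forall i, i \in C -> i != m :> nat) ->
  trunc C m.+1 = trunc C m.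
Proof.
move=> nC; apply/setP=> i; rewrite !inE ltnS leq_eqVlt.
by have [/nC/negbTE->|//] := boolP (i \in C).
Qed.

Lemma parab0 w : w \in parab set0 -> w = 1%g.
Proof.
move: w; apply: parab_ind => // i w; by rewrite inE.
Qed.

Lemma truncS_setD1 C i : trunc C i = trunc C i.+1 :\ i.
Proof.
apply/setP=> j; rewrite !inE ltnS -val_eqE ltn_neqAle /=.
by case: (_ \in C); rewrite ?andbF.
Qed.

Lemma blk_cross C i x : i \in C -> (x < i)%N ->
  blk (trunc C i.+1) x = blk (trunc C i.+1) (ord_hi i) ->
  blk (trunc C i) x = blk (trunc C i) (ord_lo i).
Proof.
move=> iC ltxi b; rewrite truncS_setD1 !blk_setD1 ?inE ?iC ?ltnSn //.
by rewrite b blk_hi ?inE ?iC ?ltnSn //= ltnn ltnNge (ltnW ltxi).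
Qed.

Lemma trunc_fix C m w x : w \in parab (trunc C m) -> (m < x)%N -> w x = x.
Proof.
move=> wC ltmx; apply: parab_fix_gt wC _ => k; rewrite inE => /andP[_].
by move=> ltk; apply: leq_ltn_trans ltmx.
Qed.

Lemma sref_ord i x : x != i :> nat -> x != i.+1 :> nat -> sref i x = x.
Proof. by move=> n1 n2; apply: ord_inj; rewrite srefP (negbTE n1) (negbTE n2). Qed.

(* Minimal coset representatives of the chain of parabolics generated by
   initial segments: each is 1 or [s_i] times one of the previous level. *)
Lemma trunc_reps C i r : i \in C ->
  ((sref i * r)%g \in parab (trunc C i.+1) :&: mrep (trunc C i)) &&
    ((sref i * r)%g != 1%g) =
  (r \in parab (trunc C i) :&: mrep (trunc C i.-1)).
Proof.
move=> iC; have iCi : i \in trunc C i.+1 by rewrite inE iC /=.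
have iNC : i \notin trunc C i by rewrite inE ltnn andbF.
have sub : trunc C i \subset trunc C i.+1.
  by apply/subsetP=> j; rewrite !inE => /andP[->] /= /ltnW.
apply/andP/idP => [[/setIP[dC dm] nd1]|/setIP[rC rm]].
  set d := (sref i * r)%g in dC dm nd1.
  have [j /[dup] dj] := ex_desc nd1; rewrite -ldescE => dj'.
  have ij : i = j.
    have := parab_ldesc dC dj'; have := mrep_asc dm; rewrite inE.
    move=> asc /andP[jC]; rewrite ltnS leq_eqVlt => /predU1P[/ord_inj->//|lt].
    by have := asc j; rewrite inE jC lt dj' => /(_ isT).
  move: dj; rewrite -{j dj'}ij => di.
  (* Nothing above i+1 moves. A preimage of i+1 below i would break monotonicity on the smaller
     block, and i+1 as its own preimage would contradict the descent at i. *)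
  have dlo : d (ord_lo i) = ord_hi i.
    case: (ltngtP (d (ord_lo i)) (ord_hi i)) => [lt|lt|/ord_inj//]; last first.
      have := trunc_fix dC lt => /perm_inj e; have := lt.
      by rewrite e /=; lia.
    pose x := d^-1%g (ord_hi i); have dx : d x = ord_hi i by rewrite permKV.
    case: (ltngtP x i) => [ltx|gtx|xi].
    - have b : blk (trunc C i.+1) x = blk (trunc C i.+1) (ord_hi i).
        by rewrite -dx (parabP _ _ dC).
      have := mrepP _ _ dm x (ord_lo i) ltx (blk_cross iC ltx b).
      by rewrite dx => h; have := ltn_trans h lt; rewrite ltnn.
    - move: gtx; rewrite leq_eqVlt => /predU1P[e|gtx].
        have {}e : ord_hi i = x by apply: ord_inj.
        by move: di; rewrite e dx => h; have := ltn_trans h lt; rewrite ltnn.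
      by have := trunc_fix dC gtx; rewrite dx => e; move: gtx; rewrite -e ltnn.
    - have e : x = ord_lo i by apply: ord_inj.
      by move: lt; rewrite -e dx ltnn.
  have rE : r = (sref i * d)%g by rewrite srefKl.
  have rhi : r (ord_hi i) = ord_hi i by rewrite rE permM sref_hi.
  have rC : r \in parab (trunc C i.+1).
    by rewrite rE groupM ?sref_parab.
  have fixr x : (i < x)%N -> r x = x.
    rewrite leq_eqVlt => /predU1P[e|]; last exact: (trunc_fix rC).
    have -> : x = ord_hi i by apply: ord_inj; rewrite -e.
    exact: rhi.
  apply/setIP; split.
    apply/parabP=> x; rewrite truncS_setD1 !blk_setD1 // (parabP _ _ rC).
    congr (_ + nat_of_bool _)%N; case: (ltnP i x) => [/fixr->//|le].
    apply/negbTE; rewrite -leqNgt leqNgt; apply/negP=> lt.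
    by have /perm_inj e := fixr _ lt; rewrite e ltnNge le in lt.
  rewrite inE; apply/forall_inP=> j; rewrite inE => /andP[jC ltj].
  have := @mrep_asc _ _ _ j dm; rewrite inE jC /= => /(_ (leq_trans ltj (leq_pred _))).
  have [|s1 s2] := @sref_far n i j; last by rewrite !ldescE rE !permM !(s1, s2).
  by apply/orP; right; move: ltj; clear; lia.
have fixr x : (i < x)%N -> r x = x := trunc_fix rC.
have ai : ~~ ldesc i r by apply: contra iNC; apply: parab_ldesc.
split; last first.
  apply: contraNneq iNC => e; apply: (@parab_ldesc _ (trunc C i) i r) => //.
  by have := ldesc_srefl i r; rewrite e (negbTE (ldesc1 i)) (negbTE ai).
apply/setIP; split.
  by rewrite groupM ?sref_parab //; apply: (subsetP (parab_sub sub)).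
rewrite inE; apply/forall_inP=> j; rewrite inE => /andP[jC ltj].
have [ltj2|gej] := ltnP j i.-1.
  have := @mrep_asc _ _ _ j rm; rewrite inE jC ltj2 => /(_ isT).
  have [|s1 s2] := @sref_far n i j; last by rewrite !ldescE !permM s1 s2.
  by apply/orP; right; move: ltj2; clear; lia.
have hj : ord_hi j = ord_lo i.
  by apply: ord_inj; move: ltj gej; clear; rewrite /=; lia.
have sj : sref i (ord_lo j) = ord_lo j.
  by apply: sref_ord; move: ltj; clear; rewrite /=; lia.
rewrite ldescE !permM hj sref_lo fixr //= sj.
rewrite -leqNgt; apply: contraT; rewrite -ltnNge => lt.
have /perm_inj e := fixr _ (ltn_trans (ltnSn _) lt).
by move: ltj; rewrite e /= in lt; move: lt; clear; lia.
Qed.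

Lemma sum_trunc_reps (V : zmodType) C i (F : 'S_n -> V) : i \in C ->
  \sum_(r in parab (trunc C i.+1) :&: mrep (trunc C i)) F r =
  F 1%g + \sum_(r in parab (trunc C i) :&: mrep (trunc C i.-1)) F (sref i * r)%g.
Proof.
move=> iC; have one : 1%g \in parab (trunc C i.+1) :&: mrep (trunc C i).
  rewrite in_setI group1 inE; apply/forall_inP=> j _; exact: ldesc1.
rewrite (bigD1 1%g) //=; congr (_ + _).
rewrite (reindex_inj (mulgI (sref i))) /=; apply: eq_bigl => r.
exact: trunc_reps.
Qed.

End Truncation.

(** * Jucys-Murphy elements and centrality of eta *)

Section JucysMurphy.

Variables (R : comNzRingType) (xi : R) (n : nat).
Local Notation H := (hecke xi n).
Local Notation T := (@hT R xi n).
Local Notation comm := GRing.comm.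
Implicit Types (i j k : 'I_n.-1) (w u v d e g : 'S_n) (h x y z : H).
Implicit Types (C K L M : {set 'I_n.-1}).

Variable J : {set 'I_n.-1}.

(* [g m] is the generator of index [m] if [m] lies in [J], and 0 otherwise;
   the zero values make the Jucys-Murphy elements restart at each block. *)
Definition jgen (m : nat) : H :=
  if insub m is Some i then (if i \in J then hgen xi i else 0) else 0.
Local Notation g := jgen.

Lemma jgenE i : i \in J -> g i = hgen xi i.
Proof. by rewrite /g valK => ->. Qed.

Lemma jgenP m : g m = 0 /\ (forall i, i \in J -> i != m :> nat) \/
  exists2 i, i \in J & m = i.
Proof.
rewrite /g; case: insubP => [i _ im|nm].
  case: ifP => iJ; [by right; exists i | left; split=> // j jJ].
  by apply: contraFneq iJ => e; rewrite (_ : i = j) //; apply: ord_inj; rewrite e.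
left; split=> // j _; apply: contraNneq nm => <-; exact: ltn_ord.
Qed.

Lemma jgen_far a b : (a.+1 < b)%N -> g a * g b = g b * g a.
Proof.
case: (jgenP a) => [[-> _]|[i iJ ->]]; first by rewrite mul0r mulr0.
case: (jgenP b) => [[-> _]|[j jJ ->]]; first by rewrite mul0r mulr0.
by have [far _ _] := hgen_rel xi n; rewrite !jgenE //; apply: far.
Qed.

Lemma jgen_braid m : g m * g m.+1 * g m = g m.+1 * g m * g m.+1.
Proof.
case: (jgenP m) => [[-> _]|[i iJ ->]]; first by rewrite !(mulr0, mul0r).
case: (jgenP i.+1) => [[-> _]|[j jJ e]]; first by rewrite !(mulr0, mul0r).
by have [_ braid _] := hgen_rel xi n; rewrite e !jgenE //; apply: braid.
Qed.

Lemma jgen_sq m : g m = 0 \/ g m * g m = 1 + xi *: g m.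
Proof.
case: (jgenP m) => [[-> _]|[i iJ ->]]; [by left | right].
by have [_ _ sq] := hgen_rel xi n; rewrite jgenE // -expr2.
Qed.

(** This is the sum of T_t over the transpositions t of m with the smaller points of its block:
    multiplying by g_p on both sides raises the moved point from p to p+1. Only generators of index
    below m occur. *)
Fixpoint jucys (m : nat) : H :=
  if m is p.+1 then g p + g p * jucys p * g p else 0.

(** The Jucys-Murphy element of the first point of a block is 0; it is replaced by 1 so that the
    product can run over all blocks. *)
Definition jfactor (m : nat) : H :=
  if [exists i in J, i == m :> nat] then jucys m.+1 else 1.

Fixpoint jprod (m : nat) : H := if m is p.+1 then jprod p * jfactor p else 1.

Lemma comm_jgen_far a b : (a.+1 < b)%N || (b.+1 < a)%N -> comm (g a) (g b).
Proof. by case/orP=> /jgen_far; rewrite /comm. Qed.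

Lemma comm_jucys_gt a m : (m < a)%N -> comm (g a) (jucys m).
Proof.
elim: m => [|m IHm] lt /=; first exact: commr0.
have c : comm (g a) (g m) by apply: comm_jgen_far; rewrite lt orbT.
by apply: commrD => //; apply: commrM => //; apply: commrM => //; apply/IHm/ltnW.
Qed.

(** The critical case is a = m-1. With A and B the generators of indices m-1 and m, and X the inner
    element, which commutes with B, the quadratic relation makes the two short terms trade places
    and the braid relation handles B A X A B. *)
Lemma comm_jucys_lt a m : (a < m)%N -> comm (g a) (jucys m.+1).
Proof.
elim: m => // m IHm; rewrite ltnS leq_eqVlt => /predU1P[->|lt]; last first.
  have c : comm (g a) (g m.+1) by apply: comm_jgen_far; rewrite ltnS lt.
  have c' := IHm lt.
  by apply: commrD => //; apply: commrM => //; apply: commrM.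
have cX : g m.+1 * jucys m = jucys m * g m.+1 by apply: comm_jucys_gt.
have br := jgen_braid m; have [A0|sq] := jgen_sq m.
  by rewrite A0; apply/commr_sym/commr0.
rewrite /comm [jucys _.+2]/= -[g m + _]/(jucys m.+1) /=.
move: (g m) (g m.+1) (jucys m) cX br sq => A B X cX br sq.
rewrite !(mulrDr, mulrDl).
have e1 : A * (B * A * B) = B * A + xi *: (A * B * A).
  by rewrite -br !mulrA sq !mulrDl mul1r -!scalerAl.
have e2 : B * A * B * A = A * B + xi *: (A * B * A).
  by rewrite -br -mulrA sq mulrDr mulr1 -!scalerAr.
have e3 : A * (B * (A * X * A) * B) = B * (A * X * A) * B * A.
  rewrite -[RHS]mulrA.
  have -> : B * (A * X * A) * (B * A) = B * A * X * (A * B * A).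
    by rewrite !mulrA.
  have -> : A * (B * (A * X * A) * B) = A * B * A * X * (A * B).
    by rewrite !mulrA.
  rewrite br -[B * A * B * X]mulrA cX !mulrA -[_ * B * A * B]mulrA.
  by rewrite -[B * A * X * B * (A * B)]mulrA [B * (A * B)]mulrA -br !mulrA.
by rewrite e1 e2 e3 -!addrA [LHS]addrCA.
Qed.

Lemma comm_jucys m : comm (jucys m) (jucys m.+1).
Proof.
have key (k : nat) : (k <= m)%N -> comm (jucys k) (jucys m.+1).
  elim: k => [|k IHk] lekm; first by apply/commr_sym/commr0.
  have c : comm (jucys m.+1) (g k) by apply/commr_sym/comm_jucys_lt.
  apply: commr_sym; rewrite [jucys k.+1]/=; apply: (commrD c).
  apply: (commrM _ c); apply: (commrM c); apply: commr_sym.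
  exact: IHk (ltnW lekm).
exact: key (leqnn m).
Qed.

(** With A the generator and X, Z the two elements, Z = A + A X A gives A X = Z A^-1 - 1 and X A =
    A^-1 Z - 1. As X and Z commute, A X Z = Z A^-1 Z - Z = Z X A = X Z A. *)
Lemma comm_jucys_pair m : comm (g m) (jucys m * jucys m.+1).
Proof.
have [A0|sq] := jgen_sq m; first by rewrite A0; apply/commr_sym/commr0.
have cXZ : jucys m * jucys m.+1 = jucys m.+1 * jucys m by apply: comm_jucys.
have ZE : jucys m.+1 = g m + g m * jucys m * g m by [].
move: (g m) (jucys m) (jucys m.+1) sq cXZ ZE => A X Z sq cXZ ZE.
have [A' [AA' A'A]] : exists A', A * A' = 1 /\ A' * A = 1.
  exists (A - xi%:A); split; first by rewrite mulrBr sq -scalerAr mulr1 addrK.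
  by rewrite mulrBl sq -scalerAl mul1r addrK.
have e1 : A * X = Z * A' - 1.
  by rewrite ZE mulrDl AA' -mulrA AA' mulr1 addrAC subrr add0r.
have e2 : X * A = A' * Z - 1.
  by rewrite ZE mulrDr !mulrA A'A mul1r addrAC subrr add0r.
by rewrite /comm mulrA e1 cXZ -mulrA e2 mulrBl mulrBr mulr1 mul1r mulrA.
Qed.

Lemma comm_jfactor a m : (a < m)%N -> comm (g a) (jfactor m).
Proof.
by rewrite /jfactor; case: ifP => _ lt; [apply: comm_jucys_lt | apply: commr1].
Qed.

Lemma comm_jprod_gt a m : (m < a)%N -> comm (g a) (jprod m).
Proof.
elim: m => [|m IHm] lt; first exact: commr1.
apply: commrM; first exact/IHm/ltnW.
by rewrite /jfactor; case: ifP => _; [apply: comm_jucys_gt | apply: commr1].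
Qed.

Lemma jfactor_in i : i \in J -> jfactor i = jucys i.+1.
Proof.
by rewrite /jfactor => iJ; case: existsP => // -[]; exists i; rewrite iJ eqxx.
Qed.

Lemma jfactor_notin m : (forall i, i \in J -> i != m :> nat) -> jfactor m = 1.
Proof.
by move=> h; rewrite /jfactor; case: existsP => // -[i /andP[/h/negbTE->]].
Qed.

(** Only the factors at a-1 and a may fail to commute with g_a separately; their product does
    commute, by [comm_jucys_pair]. *)
Lemma comm_jprod a m : (a < m)%N -> comm (g a) (jprod m).
Proof.
elim: m => // m IHm; rewrite ltnS leq_eqVlt => /predU1P[->|lt]; last first.
  by apply: commrM; [apply: IHm | apply: comm_jfactor].
case: (jgenP m) => [[-> _]|[i iJ ->]]; first by apply/commr_sym/commr0.
rewrite /= jfactor_in //.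
case: (i : nat) => [|p].
  rewrite mul1r /= mulr0 mul0r addr0; exact: commr_refl.
rewrite [jprod _]/= -mulrA; apply: commrM; first exact: comm_jprod_gt.
(* If p is outside J, a block begins at p+1 and the last factor is the generator alone. *)
case: (jgenP p) => [[g0 h]|[j jJ ->]].
  rewrite jfactor_notin // mul1r /= g0 !mul0r addr0 mulr0 mul0r addr0.
  exact: commr_refl.
by rewrite jfactor_in //; apply: comm_jucys_pair.
Qed.

Lemma comm_jprod_T m w : w \in parab (trunc J m) -> comm (jprod m) (T w).
Proof.
move: w; apply: parab_ind => [|i w]; first exact: commr1.
rewrite inE => /andP[iJ lti] _ ai IH; rewrite -hgen_asc //.
apply: commrM => //; rewrite -jgenE //; exact/commr_sym/comm_jprod.
Qed.

Lemma comm_T_gt C m i w : i \in J -> (m <= i)%N -> w \in parab (trunc C m.-1) ->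
  comm (hgen xi i) (T w).
Proof.
move=> iJ lemi; move: w; apply: parab_ind => [|j w]; first exact: commr1.
rewrite inE => /andP[_ ltj] _ aj IH; rewrite -hgen_asc //.
have [far _ _] := hgen_rel xi n.
by apply: commrM => //; rewrite /comm [RHS]far //; move: ltj lemi; clear; lia.
Qed.

Definition jsum m : H :=
  \sum_(r in parab (trunc (prec J) m) :&: mrep (trunc (prec J) m.-1))
    T r^-1%g * g m * T r.

Lemma mrep_self C : parab C :&: mrep C = [set 1%g].
Proof.
have m1 : 1%g \in mrep C.
  by rewrite inE; apply/forall_inP=> j _; apply: ldesc1.
apply/setP=> r; rewrite in_setI in_set1.
apply/andP/eqP => [[rC rm]|->]; last by rewrite group1.
have E : (r * 1 = 1 * r)%g by rewrite mulg1 mul1g.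
by have [] := parab_decomp_uniq rC (group1 _) m1 rm E.
Qed.

(** For p = i-1 in [prec J] the representatives are 1, contributing g_i, and s_p r with r one level
    down. In the latter the braid relation turns g_p g_i g_p into g_i g_p g_i, whose outer factors
    commute with T_r, and the recursion of [jucys] appears. *)
Lemma jsumE i : i \in J -> jsum i = jucys i.+1.
Proof.
have [k] := ubnP i; elim: k i => // k IHk i ltik iJ.
have [[p pP]|np] := altP (@existsP _ (fun p => (p \in prec J) && (p.+1 == i :> nat))).
  have /andP[pJ /eqP ip] := pP; have pJ' := subsetP (prec_sub J) _ pJ.
  rewrite /jsum -ip [_.+1.-1]/= sum_trunc_reps // invg1 !hT1 mul1r mulr1.
  rewrite ip /=; congr (_ + _); rewrite -ip /= -/(jucys p.+1) -IHk //; last by lia.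
  rewrite /jsum mulr_sumr mulr_suml; apply: eq_bigr => r /setIP[rC rm].
  have ar : ~~ ldesc p r.
    by apply: contraL rC => dp; apply/negP=> /parab_ldesc/(_ dp); rewrite inE ltnn andbF.
  rewrite -hgen_asc // invMg srefV hT_Msref ?invgK // -(jgenE pJ').
  have c u : u \in parab (trunc (prec J) p) -> comm (g p.+1) (T u).
    rewrite ip jgenE // => uC; apply: (@comm_T_gt (prec J) p.+1) uC => //.
    by rewrite ip.
  rewrite -!mulrA [g p * (g p.+1 * _)]mulrA [g p * g p.+1 * _]mulrA jgen_braid.
  by rewrite -!mulrA c // !mulrA -(c _ (groupVr rC)).
(* Otherwise i = 0 or i-1 is outside J: the only representative is 1, and [jucys] reduces to g_i. *)
have trE : trunc (prec J) i = trunc (prec J) i.-1.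
  case ei : (i : nat) => [|m] //=; apply: trunc_notin => j jp.
  by apply: contra np => /eqP jm; apply/existsP; exists j; rewrite jp jm ei /=.
rewrite /jsum -trE mrep_self big_set1 invg1 !hT1 mul1r mulr1.
case ei: (i : nat) => [|p] /=; first by rewrite mulr0 mul0r addr0.
case: (jgenP p) => [[g0 _]|[j jJ jp]].
  by rewrite g0 !mul0r addr0 mulr0 mul0r addr0.
case/existsP: np; exists j; rewrite ei -jp eqxx andbT inE jJ.
by apply/exists_inP; exists i; rewrite // ei jp.
Qed.

Lemma cox_truncS i : i \in J ->
  cox (trunc J i.+1) = (cox (trunc J i) * sref i)%g.
Proof.
move=> iJ; have iT : i \in trunc J i.+1 by rewrite inE iJ /=.
have sub : trunc J i \subset trunc J i.+1.
  by apply/subsetP=> j; rewrite !inE => /andP[->] /= /ltnW.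
apply/esym/cox_uniq.
  by rewrite groupM ?sref_parab //; apply: (subsetP (parab_sub sub)) (cox_parab _).
move=> j; rewrite inE ltnS leq_eqVlt => /andP[jJ /predU1P[/ord_inj->|lt]].
  by rewrite permM (trunc_fix (cox_parab _)) ?sref_hi /=.
rewrite permM cox_hi ?inE ?jJ // sref_ord //=; move: lt; clear; lia.
Qed.

Lemma trunc_prec m : prec (trunc J m.+1) = trunc (prec J) m.
Proof.
apply/setP=> i; rewrite !inE -!andbA; apply: andb_id2l => iJ.
rewrite [RHS]andbC; apply/andP/andP => [[_ /exists_inP[j]]|[lt /exists_inP[j jJ /eqP ji]]].
  rewrite inE ltnS => /andP[jJ lt] /eqP ji; rewrite -ji lt.
  by split=> //; apply/exists_inP; exists j; rewrite ?ji.
split; first exact: ltnW.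
by apply/exists_inP; exists j; rewrite ?inE ?jJ ?ji.
Qed.

(** Adding index i multiplies the Coxeter element by s_i on the right. The new representatives pass
    through the previous eta, already known to be central in its subalgebra, and leave the factor
    [jsum i]. *)
Lemma eta_jprod m : eta xi (trunc J m) = jprod m.
Proof.
elim: m => [|m IHm].
  rewrite /eta (_ : prec _ = set0); last first.
    by apply/setP=> i; rewrite trunc0 !inE.
  rewrite (big_pred1 1%g) => [|w]; last first.
    by apply/idP/eqP => [/parab0|->]; rewrite ?group1.
  by rewrite (parab0 (_ : cox _ \in _)) ?invg1 ?hT1 ?mulr1 // -(trunc0 J) cox_parab.
case: (jgenP m) => [[_ nm]|[i iJ ->{m}]] in IHm *.
  by rewrite /= jfactor_notin // trunc_notin // mulr1.
rewrite /= jfactor_in // -jsumE // -IHm /eta trunc_prec.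
have sub1 : trunc (prec J) i.-1 \subset trunc (prec J) i.
  by apply/subsetP=> j; rewrite !inE => /andP[->] /= /leq_trans; apply; apply: leq_pred.
have sub2 : trunc (prec J) i \subset trunc J i.
  apply/subsetP=> j; rewrite !inE => /andP[/andP[-> _] ->] //.
have pE : prec (trunc J i) = trunc (prec J) i.-1.
  case: (i : nat) => [|p]; last exact: trunc_prec.
  by rewrite !trunc0; apply/setP=> j; rewrite !inE.
rewrite (sum_parab_l _ sub1) /jsum mulr_sumr; apply: eq_bigr => r /setIP[rC rm].
have etaC : comm (eta xi (trunc J i)) (T r^-1%g).
  by rewrite IHm; apply: comm_jprod_T; rewrite groupV (subsetP (parab_sub sub2)).
rewrite jgenE // -[T r^-1%g * _ * _]mulrA [RHS]mulrA -/(eta _ _).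
rewrite etaC.
have coxT : T (cox (trunc J i.+1)) = T (cox (trunc J i)) * hgen xi i.
  rewrite cox_truncS // hT_Msref //; apply/negP.
  move=> di; have := parab_ldesc (groupVr (cox_parab _)) di.
  by rewrite inE ltnn andbF.
rewrite /eta pE mulr_sumr mulr_suml; apply: eq_bigr => u uB.
rewrite (hT_parabM xi uB rm) invMg (@hT_Mparab _ xi _ (trunc (prec J) i.-1)) ?invgK ?groupV //.
have := comm_T_gt iJ (leqnn i) uB; rewrite /comm coxT => c.
by rewrite -!mulrA [hgen xi i * (T u * _)]mulrA c -!mulrA.
Qed.

Lemma eta_comm w : w \in parab J -> eta xi J * T w = T w * eta xi J.
Proof.
have trE : trunc J n.-1 = J.
  by apply/setP=> i; rewrite inE ltn_ord andbT.
by move=> wJ; rewrite -trE eta_jprod; apply: comm_jprod_T; rewrite trE.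
Qed.

End JucysMurphy.

(** * Support of eta and the Mackey formula *)

Section Mackey.

Variables (R : comNzRingType) (xi : R) (n : nat).
Local Notation H := (hecke xi n).
Local Notation T := (@hT R xi n).
Implicit Types (i j k : 'I_n.-1) (w u v d e g : 'S_n).
Implicit Types (J K L M : {set 'I_n.-1}).

Lemma hcoord_mrepM L d g u : d \in mrep L -> u \in parab L ->
  hcoord (T d * T g) u = (g == (d^-1 * u)%g)%:R.
Proof.
move=> dL uL; rewrite -hcoordTM mulrA -(@hT_parabM _ xi _ L) ?groupV //.
by rewrite hcoordTT invMg !invgK.
Qed.

(** Such a conjugate is still transitive on each J-block, whereas [parab (J :\ i)] separates the
    points i and i+1. *)
Lemma cox_conj_notin J i e : i \in J -> e \in parab J ->
  (cox J ^ e)%g \notin parab (J :\ i).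
Proof.
move=> iJ eJ; apply/negP=> /cox_conj_blk/(@blk_const _ _ _ (fun z => blk _ (e z))).
move=> /(_ (e^-1 (ord_lo i))%g (e^-1 (ord_hi i))%g) /=; rewrite !permKV.
rewrite !blk_setD1 // blk_hi // ltnn ltnSn addn0 addn1.
have /parabP eV := groupVr eJ; rewrite !eV blk_hi // => /(_ erefl).
by clear; lia.
Qed.

(** For j in [prec J] the inverse of [cox J] sends j, j+1 to j+1, j+2, so [cox J] has no right
    descent in [prec J]. *)
Lemma hTM_cox J d : d \in parab (prec J) -> T (cox J * d)%g = T (cox J) * T d.
Proof.
apply: hT_Mparab; rewrite inE; apply/forall_inP=> j.
rewrite inE => /andP[jJ /exists_inP[k kJ /eqP/ord_lo_succ kj]].
have cV i : i \in J -> (cox J)^-1%g (ord_lo i) = ord_hi i.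
  by move=> /cox_hi<-; rewrite permK.
by rewrite ldescE cV // -kj cV // -leqNgt /=.
Qed.

(** The coordinate at w is a trace. Writing d^-1 = u d0 with d0 minimal for L, cyclicity leaves the
    trace of an element of H_L times Z = T_d0 T_(cox J d0^-1). A nonzero coordinate of Z in
    [parab L] would give a conjugate of [cox J] excluded by [cox_conj_notin]. *)
Lemma eta_full J i w : i \in J -> w \in parab (J :\ i) ->
  hcoord (eta xi J) w = 0.
Proof.
move=> iJ wL; rewrite hcoord_sum big1 // => d dP; set L := J :\ i in wL *.
have [u [d0 [uL d0m dE]]] := parab_decomp (prec J :\ i) d^-1%g.
have sub : prec J :\ i \subset L by rewrite setSD // prec_sub.
have uP : u \in parab (prec J) by rewrite (subsetP (parab_sub (subsetDl _ [set i]))).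
have d0P : d0 \in parab (prec J).
  by rewrite -(groupMl _ uP) -dE groupV.
(* Left descents of d0 lie in [prec J], so minimality for [prec J :\ i] gives minimality for all of
   L. *)
have d0L : d0 \in mrep L.
  rewrite inE; apply/forall_inP=> j; rewrite !inE => /andP[ji jJ].
  have [jP|] := boolP (j \in prec J); first by apply: (mrep_asc d0m); rewrite in_setD1 ji.
  by apply: contra => /(parab_ldesc d0P).
have {}uL : u \in parab L by rewrite (subsetP (parab_sub sub)).
have dE' : d = (d0^-1 * u^-1)%g by rewrite -[d]invgK dE invMg.
have e0P : d0^-1%g \in parab (prec J) by rewrite groupV.
rewrite -hcoordTM dE (hT_parabM xi uL d0L) dE'.
rewrite (@hT_Mparab _ xi _ L) ?invgK ?groupV //.
pose a := T u^-1%g * T w^-1%g * T u; pose Z := T d0 * T (cox J * d0^-1)%g.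
have -> : T w^-1%g * (T u * T d0 * T (cox J) * (T d0^-1%g * T u^-1%g)) =
    T w^-1%g * T u * Z * T u^-1%g.
  by rewrite /Z hTM_cox // !mulrA.
rewrite htauC (_ : _ * _ = a * Z); last by rewrite /a !mulrA.
have aL : pj L a = a.
  by rewrite /a -mulrA !pj_Tl ?groupV // pjT.
rewrite -(htau_pj L) pj_Ml // (_ : pj L Z = 0) ?mulr0 ?[LHS]ffunE //.
apply: hcoordP => v; rewrite hcoord_pj [RHS]ffunE; case: ifP => // vL.
rewrite /Z (hcoord_mrepM _ d0L vL); case: eqP => // E.
have := cox_conj_notin iJ (subsetP (parab_sub (prec_sub J)) _ e0P).
by rewrite conjgE invgK E mulKVg vL.
Qed.

(** Write g^-1 = u d with u in [parab M] and d minimal; d^-1 transports K onto some N inside M. This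
    N is M, since otherwise a conjugate of [cox M] would lie in a smaller parabolic. *)
Lemma relnorm_cox_conj L K M g : K \subset L -> M \subset L -> g \in parab L ->
    (cox K ^ g)%g = cox M ->
  relnorm (parab L) (parab K) (eta xi K) = relnorm (parab L) (parab M) (eta xi M).
Proof.
move=> sKL sML gL E.
have [u [d [uM dM gE]]] := parab_decomp M g^-1%g.
have eM : d^-1^-1%g \in mrep M by rewrite invgK.
have gE' : g = (d^-1 * u^-1)%g by rewrite -[g]invgK gE invMg.
have uL : u \in parab L by rewrite (subsetP (parab_sub sML)).
have eL : d^-1%g \in parab L by rewrite groupV -(groupMl _ uL) -gE groupV.
have cE : (cox K ^ d^-1 = cox M ^ u)%g by rewrite -E gE' -!conjgM mulgKV.
have cM : (cox K ^ d^-1)%g \in parab M by rewrite cE groupJ ?cox_parab.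
have [N sNM tN] := cox_conj_transports eM cM.
have {sNM} NM : N = M.
  apply/eqP; rewrite eqEsubset sNM; apply/subsetP=> k kM; apply: contraT => kN.
  have := cox_conj_notin kM uM; rewrite -cE (transports_cox tN).
  rewrite (subsetP (parab_sub _) _ (cox_parab N)) //.
  apply/subsetP=> j jN; rewrite !inE (subsetP sNM) // andbT.
  by apply: contraNneq kN => <-.
rewrite {}NM in tN; have [y [yT Ty]] := hT_invertible xi d^-1%g.
rewrite (relnorm_transport sKL sML eL tN yT Ty (@eta_comm _ xi _ K)).
by rewrite (eta_transport tN yT).
Qed.

(** By [hcoord_mrepM], T_(e^-1) T_(w e) has a nonzero coordinate at u in [parab L] only for w e = e
    u. *)
Lemma pj_conjT J L e w : e \in mrep J -> e^-1%g \in mrep L -> w \in parab J ->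
  pj L (T e^-1%g * T w * T e) =
    if (w ^ e)%g \in parab L then T (w ^ e)%g else 0.
Proof.
move=> eJ eL wJ; rewrite -mulrA -(hT_parabM xi wJ eJ).
apply: hcoordP => u; rewrite hcoord_pj; case: (boolP (u \in _)) => uL.
  rewrite (hcoord_mrepM _ eL uL) invgK.
  have -> : ((w * e)%g == (e * u)%g) = (u == (w ^ e)%g).
    rewrite conjgE; apply/eqP/eqP => [E|->]; last by rewrite mulKVg.
    by rewrite E mulKg.
  case: eqP => [<-|nu]; first by rewrite uL hcoordT eqxx.
  by case: ifP => _; rewrite ?hcoordT ?[RHS]ffunE //; case: eqP.
case: ifP => weL; rewrite ?hcoordT ?[RHS]ffunE //.
by case: eqP => // uE; rewrite uE weL in uL.
Qed.

(** Under the projection T_(e^-1) has the same effect as the inverse of T_e, for which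
    [eta_transport] applies. *)
Lemma pj_conj_eta J L e K : K \subset L -> e^-1%g \in mrep L -> transports e J K ->
  pj L (T e^-1%g * eta xi J * T e) = eta xi K.
Proof.
move=> sKL eL eJK; have [y [yT _]] := hT_invertible xi e.
rewrite -(eta_transport eJK yT) -(pj_eta xi J) /pj.
rewrite -/(pj L _) !mulr_sumr !mulr_suml linear_sum; apply: eq_bigr => w wJ.
rewrite -!scalerAr -!scalerAl linearZ /= (pj_conjT (transports_mrep eJK)) //.
rewrite (subsetP (parab_sub sKL)) ?(transports_parab eJK) //.
by rewrite -[y * _ * _]mulrA (transports_T xi eJK wJ) mulrA yT mul1r.
Qed.

(** A surviving w in the support of eta lies in no smaller parabolic, so by [full_conj_blk] e would
    transport J into L, and [cox J] with it. *)
Lemma pj_conj_eta0 J L e : e \in mrep J -> e^-1%g \in mrep L ->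
  (cox J ^ e)%g \notin parab L -> pj L (T e^-1%g * eta xi J * T e) = 0.
Proof.
move=> eJ eL cL; rewrite -(pj_eta xi J) [pj J _]/pj.
rewrite mulr_sumr mulr_suml linear_sum big1 // => w wJ.
rewrite -scalerAr -scalerAl linearZ /= (pj_conjT eJ eL wJ).
case: ifP => weL; last by rewrite scaler0.
have [/exists_inP[i iJ wi]|full] := boolP [exists i in J, w \in parab (J :\ i)].
  by rewrite (eta_full iJ wi) scale0r.
have wfull i : i \in J -> w \notin parab (J :\ i).
  by move=> iJ; apply: contra full => wi; apply/exists_inP; exists i.
have [K sKL eJK] := transports_ex eJ eL (full_conj_blk eJ wJ wfull weL).
case/negP: cL; rewrite (transports_cox eJK).
exact: subsetP (parab_sub sKL) _ (cox_parab K).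
Qed.

Lemma mrep_dropr J L e v : e^-1%g \in mrep L -> v \in parab L ->
  (e * v)%g \in mrep J -> e \in mrep J.
Proof.
move=> /mrepP eL /parabP vL /mrepP evJ; apply/mrepP=> x y ltxy b.
have := evJ x y ltxy b; rewrite !permM => lt; rewrite ltnNge; apply/negP.
rewrite leq_eqVlt => /predU1P[/ord_inj/perm_inj e1|lt2].
  by rewrite e1 ltnn in ltxy.
have b2 : blk L (e y) = blk L (e x).
  apply/eqP; rewrite eqn_leq (blk_mono L (ltnW lt2)) /=.
  by rewrite -(vL (e x)) -(vL (e y)) (blk_mono L (ltnW lt)).
have := eL _ _ lt2 b2; rewrite !permK => h.
by have := ltn_trans ltxy h; rewrite ltnn.
Qed.

Lemma mrep_transports J K e v : transports e J K ->
  ((e * v)%g \in mrep J) = (v \in mrep K).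
Proof.
case=> eJ eK; rewrite !inE; apply/forall_inP/forall_inP => [h k /eK|h i /eJ].
  by case=> i iJ [e1 e2]; have := h i iJ; rewrite !ldescE !permM e1 e2.
by case=> k kK [e1 e2]; have := h k kK; rewrite !ldescE !permM e1 e2.
Qed.

(* Mackey decomposition, summed over all of ['S_n] instead of over double
   coset representatives. *)
Lemma mackey J L (F : 'S_n -> H) :
    (forall K, K \subset L ->
       F (cox K) = relnorm (parab L) (parab K) (eta xi K)) ->
    (forall w u, w \in parab L -> u \in parab L -> F (w ^ u)%g = F w) ->
  #|parab L|%:R *: pj L (relnorm [set: 'S_n] (parab J) (eta xi J)) =
    \sum_(g | (cox J ^ g)%g \in parab L) F (cox J ^ g)%g.
Proof.
move=> Fcox Fconj.
have inT g : g \in parab [set: 'I_n.-1] by rewrite parabT inE.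
have -> : \sum_(g | (cox J ^ g)%g \in parab L) F (cox J ^ g)%g =
    \sum_(g in parab setT)
      (if (cox J ^ g)%g \in parab L then F (cox J ^ g)%g else 0).
  by rewrite -big_mkcondr; apply: eq_bigl => g; rewrite inT.
(* Both sides are summed over g = e v with v in [parab L] and e minimal in its coset, and are
   compared for each e separately. *)
rewrite [RHS](sum_parab_r _ (subsetT L)) -parabT relnormE.
have -> : \sum_(d in parab setT :&: mrep J) T d^-1%g * eta xi J * T d =
    \sum_(d in parab setT)
      (if d \in mrep J then T d^-1%g * eta xi J * T d else 0).
  by rewrite -big_mkcondr; apply: eq_bigl => g; rewrite in_setI.
rewrite [X in pj L X](sum_parab_r _ (subsetT L)) [pj L _]linear_sum.
rewrite scaler_sumr.
apply: eq_bigr => e /andP[_ eL] /=.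
have -> : \sum_(v in parab L) (if (cox J ^ (e * v))%g \in parab L
      then F (cox J ^ (e * v))%g else 0) =
    #|parab L|%:R *: (if (cox J ^ e)%g \in parab L then F (cox J ^ e)%g else 0).
  rewrite scaler_nat -sumr_const; apply: eq_bigr => v vL.
  by rewrite conjgM groupJr //; case: ifP => // cL; apply: Fconj.
congr (_ *: _); have Tev v : v \in parab L ->
    T (e * v)^-1%g * eta xi J * T (e * v)%g =
    T v^-1%g * (T e^-1%g * eta xi J * T e) * T v.
  move=> vL; rewrite (@hT_Mparab _ xi _ L) // invMg.
  by rewrite (@hT_parabM _ xi _ L) ?groupV // !mulrA.
have pjv v z : v \in parab L ->
    pj L (T v^-1%g * z * T v) = T v^-1%g * pj L z * T v.
  by move=> vL; rewrite pj_Mr ?pjT // pj_Tl ?groupV.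
rewrite linear_sum; case: ifP => cL.
  have [K sKL eJK] := cox_conj_transports eL cL.
  rewrite (transports_cox eJK) Fcox // relnormE.
  (* Since e transports J to K, e v is minimal for J exactly when v is minimal for K, so the sum
     over v is a norm from [parab K]. *)
  under [RHS]eq_bigl do rewrite in_setI.
  rewrite big_mkcondr; apply: eq_bigr => v vL /=.
  rewrite (mrep_transports _ eJK); case: ifP => _; last exact: linear0.
  by rewrite Tev // pjv // (pj_conj_eta sKL).
apply: big1 => v vL /=; case: ifP => evJ; last exact: linear0.
have eJ := mrep_dropr eL vL evJ.
by rewrite Tev // pjv // pj_conj_eta0 ?cL // mulr0 mul0r.
Qed.

End Mackey.

(** * Conjugacy by cycle types within blocks *)

Section CycleTypes.

Lemma matching_of_perm_map (T1 T2 : eqType) (f1 : T1 -> nat) (f2 : T2 -> nat)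
    (y0 : T2) (s1 : seq T1) (s2 : seq T2) :
    uniq s2 -> perm_eq (map f1 s1) (map f2 s2) ->
  exists2 phi : T1 -> T2, {in s1 &, injective phi} &
    forall x, x \in s1 -> phi x \in s2 /\ f2 (phi x) = f1 x.
Proof.
move=> u2 /(perm_iotaP 0%N)[Is pI e]; rewrite size_map in pI.
have sI : size Is = size s1 by rewrite -(size_map f1 s1) e size_map.
have uI : uniq Is by rewrite (perm_uniq pI) iota_uniq.
have idx x : x \in s1 -> (index x s1 < size Is)%N by rewrite sI index_mem.
have ltI x : x \in s1 -> (nth 0 Is (index x s1) < size s2)%N.
  by move=> /idx/(mem_nth 0%N); rewrite (perm_mem pI) mem_iota.
exists (fun x => nth y0 s2 (nth 0 Is (index x s1))) => [x x' xs xs' /eqP|x xs].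
  rewrite nth_uniq ?ltI // nth_uniq ?idx // => /eqP.
  exact: index_inj.
split; first by rewrite mem_nth ?ltI.
have := congr1 (fun t => nth 0%N t (index x s1)) e.
rewrite /= (nth_map x) ?index_mem // nth_index // => ->.
by rewrite (nth_map 0%N) ?idx // (nth_map y0) ?ltI.
Qed.

Lemma eq_expg_porbit (T : finType) (s : {perm T}) r i j :
  ((s ^+ i)%g r == (s ^+ j)%g r) = (i == j %[mod #|porbit s r|]).
Proof.
set c := #|porbit s r|; have c_gt0 : (0 < c)%N by rewrite lt0n card_porbit_neq0.
have sc : (s ^+ c)%g r = r by rewrite permX; apply: iter_porbit.
have s0 q : (s ^+ (q * c))%g r = r.
  elim: q => [|q IHq]; first by rewrite mul0n expg0 perm1.
  by rewrite mulSn expgD permM sc.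
have red k : (s ^+ k)%g r = nth r (traject s r c) (k %% c)%N.
  rewrite nth_traject ?ltn_pmod // {1}(divn_eq k c) expgD permM s0.
  exact: permX.
by rewrite !red nth_uniq ?size_traject ?ltn_pmod // uniq_traject_porbit.
Qed.

Variable n : nat.
Implicit Types (w u v g : 'S_n) (x y : 'I_n) (B o : {set 'I_n}).

Definition orbits_in B w : seq {set 'I_n} := 
  [seq o : {set 'I_n} <- enum (porbits w) | o \subset B].

Lemma orbits_in_uniq B w : uniq (orbits_in B w).
Proof. by rewrite filter_uniq // enum_uniq. Qed.

Definition stable_on w B := forall x, (w x \in B) = (x \in B).

Lemma stable_expg w B (k : nat) x : stable_on w B -> ((w ^+ k)%g x \in B) = (x \in B).
Proof.
move=> wB; elim: k => [|k IHk]; first by rewrite expg0 perm1.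
by rewrite expgSr permM wB.
Qed.

Lemma stable_porbit w B x : stable_on w B -> (porbit w x \subset B) = (x \in B).
Proof.
move=> wB; apply/subsetP/idP => [|xB y /porbitP[k ->]].
  by apply; apply: porbit_id.
by rewrite stable_expg.
Qed.

Lemma mem_orbits_in w B x : stable_on w B ->
  (porbit w x \in orbits_in B w) = (x \in B).
Proof.
by move=> wB; rewrite mem_filter stable_porbit // mem_enum imset_f ?andbT.
Qed.

Lemma orbits_inP w B o : o \in orbits_in B w ->
  o \subset B /\ forall x, x \in o -> o = porbit w x.
Proof.
rewrite mem_filter mem_enum => /andP[sB /imsetP[z _ oE]]; split=> // x.
by rewrite oE -eq_porbit_mem => /eqP.
Qed.

Lemma perm_cycle_type B w : perm_eq (cycle_type B w) [seq #|o| | o : {set 'I_n} <- orbits_in B w].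
Proof. by rewrite perm_sort. Qed.

(* Orbits of [w] and [w'] of the same size inside each block are matched, and
   [w^k r] is sent to [w'^k r'] for chosen points [r], [r'] of matched orbits. *)
Lemma conj_of_cycle_type (Bs : seq {set 'I_n}) w w' :
    (forall x, exists2 B, B \in Bs & x \in B) ->
    (forall B B' x, B \in Bs -> B' \in Bs -> x \in B -> x \in B' -> B = B') ->
    (forall B, B \in Bs -> stable_on w B) ->
    (forall B, B \in Bs -> stable_on w' B) ->
    (forall B, B \in Bs -> cycle_type B w = cycle_type B w') ->
  exists2 g, forall B, B \in Bs -> stable_on g B & (w ^ g)%g = w'.
Proof.
move=> cover disj wB w'B ct.
have /fin_all_exists[phi phiP] : forall B, exists phi : {set 'I_n} -> {set 'I_n},
    B \in Bs -> {in orbits_in B w &, injective phi} /\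
    forall o, o \in orbits_in B w -> phi o \in orbits_in B w' /\ #|phi o| = #|o|.
  move=> B; have [BBs|nB] := boolP (B \in Bs); last by exists id.
  have pe : perm_eq [seq #|o| | o : {set 'I_n} <- orbits_in B w]
                    [seq #|o| | o : {set 'I_n} <- orbits_in B w'].
    by rewrite -(permPl (perm_cycle_type B w)) ct // perm_cycle_type.
  have [phi inj phiE] := matching_of_perm_map set0 (orbits_in_uniq B w') pe.
  by exists phi.
(* The base points r and r' depend only on the orbit of x; the exponent k matters only modulo the
   orbit size, which is the same on both sides. *)
pose P x y := exists B r r' k, [/\ B \in Bs, x \in B,
  [pick z in porbit w x] = Some r, [pick z in phi B (porbit w x)] = Some r'
  & x = (w ^+ k)%g r /\ y = (w' ^+ k)%g r'].
have facts B x r r' : B \in Bs -> x \in B -> [pick z in porbit w x] = Some r ->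
    [pick z in phi B (porbit w x)] = Some r' ->
  [/\ porbit w x = porbit w r, phi B (porbit w x) = porbit w' r',
      #|porbit w' r'| = #|porbit w r| & porbit w' r' \subset B].
  move=> BBs xB; case: pickP => // z; rewrite -eq_porbit_mem => /eqP zx [<-].
  have oB : porbit w x \in orbits_in B w by rewrite mem_orbits_in //; apply: wB.
  have [_ /(_ _ oB)[phB phc]] := phiP B BBs; have [sB phE] := orbits_inP phB.
  case: pickP => // z' z'o [<-]; rewrite -(phE _ z'o) phc.
  by rewrite zx; split.
have ex x : exists y, P x y.
  have [B BBs xB] := cover x.
  have oB : porbit w x \in orbits_in B w by rewrite mem_orbits_in //; apply: wB.
  case pr : [pick z in porbit w x] => [r|]; last first.
    by move: pr; case: pickP => // /(_ x); rewrite porbit_id.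
  have [_ /(_ _ oB)[phB phc]] := phiP B BBs.
  case pr' : [pick z in phi B (porbit w x)] => [r'|]; last first.
    move: pr'; case: pickP => // none _; move: phc (card_porbit_neq0 w x).
    by rewrite (eq_card0 none) => <-.
  have [e _ _ _] := facts B x r r' BBs xB pr pr'.
  have /porbitP[k xk] : x \in porbit w r by rewrite -e porbit_id.
  by exists ((w' ^+ k)%g r'), B, r, r', k.
have key x y x1 y1 : P x y -> P x1 y1 -> porbit w x = porbit w x1 ->
    (x == x1) = (y == y1).
  move=> [B [r [r' [k [BBs xB pr pr' [xk yk]]]]]].
  move=> [B1 [r1 [r1' [k1 [BBs1 xB1 pr1 pr1' [xk1 yk1]]]]]] exx.
  have eB : B1 = B.
    apply: (disj _ _ x1) => //; rewrite -(stable_porbit _ (wB B BBs)) -exx.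
    by rewrite stable_porbit //; apply: wB.
  rewrite eB -exx pr' in pr1'; rewrite -exx pr in pr1.
  case: pr1 pr1' => <- [<-] in xk1 yk1 *.
  have [_ _ cc _] := facts B x r r' BBs xB pr pr'.
  by rewrite xk yk xk1 yk1 !eq_expg_porbit cc.
have yin B x y : P x y -> B \in Bs -> (y \in B) = (x \in B).
  move=> [B1 [r [r' [k [BBs xB pr pr' [_ yk]]]]]] BBs1.
  have [_ _ _ /subsetP sB] := facts B1 x r r' BBs xB pr pr'.
  have yB : y \in B1 by apply: sB; rewrite yk mem_porbit.
  apply/idP/idP => h; first by rewrite (disj B B1 y).
  by rewrite (disj B B1 x).
have /fin_all_exists[f fP] := ex.
(* Equal images force the matched orbits to coincide, hence the original ones by injectivity of
   [phi B]; [key] then settles the points. *)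
have f_inj : injective f.
  move=> x x1 e; apply/eqP.
  have [B [r [r' [k [BBs xB pr pr' [xk yk]]]]]] := fP x.
  have xB1 : x1 \in B by rewrite -(yin B x1 (f x1)) // -e (yin B x).
  rewrite (key _ _ _ _ (fP x) (fP x1)) ?e //.
  have [B1 [r1 [r1' [k1 [BBs1 xB2 pr1 pr1' [xk1 yk1]]]]]] := fP x1.
  rewrite {xB2 BBs1}(disj B1 B x1 BBs1 BBs xB2 xB1) in pr1'.
  have [_ e1 _ _] := facts B x r r' BBs xB pr pr'.
  have [_ e2 _ _] := facts B x1 r1 r1' BBs xB1 pr1 pr1'.
  have [inj _] := phiP B BBs; apply: inj.
  - by rewrite mem_orbits_in //; apply: wB.
  - by rewrite mem_orbits_in //; apply: wB.
  rewrite e1 e2 -(porbit_perm w' k r') -yk; apply/eqP.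
  by rewrite eq_porbit_mem e yk1 mem_porbit.
exists (perm f_inj); first by move=> B BBs x; rewrite permE (yin B x).
apply/permP=> y; rewrite -[y](permKV (perm f_inj)).
move: ((perm f_inj)^-1%g y) => x; rewrite permJ !permE; apply/eqP.
have Pwx : P (w x) (w' (f x)).
  have [B [r [r' [k [BBs xB pr pr' [xk yk]]]]]] := fP x.
  have ew : porbit w (w x) = porbit w x.
    by have := porbit_perm w 1 x; rewrite expg1.
  exists B, r, r', k.+1; rewrite ew (wB _ BBs); split=> //.
  by rewrite !expgSr !permM -xk -yk.
by rewrite -(key _ _ _ _ (fP (w x)) Pwx).
Qed.

Lemma cycle_type_conj B w g : stable_on g B -> cycle_type B (w ^ g)%g = cycle_type B w.
Proof.
move=> gB; have geqT : total geq by move=> a b; apply: leq_total.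
have geqt : transitive geq by move=> a b c /[swap]; apply: leq_trans.
have geqa : antisymmetric geq by move=> a b; rewrite andbC => /anti_leq.
apply/(perm_sortP geqT geqt geqa).
pose G o := g @: o; have Ginj : injective G by apply: imset_inj; apply: perm_inj.
have GJ x : G (porbit w x) = porbit (w ^ g)%g (g x).
  apply/setP=> y; apply/imsetP/porbitP => [[z /porbitP[k ->] ->]|[k ->]].
    by exists k; rewrite -conjXg permJ.
  by exists ((w ^+ k)%g x); rewrite ?mem_porbit // -conjXg permJ.
have gsub o : (G o \subset B) = (o \subset B).
  apply/subsetP/subsetP => h x xo; last by case/imsetP: xo => z /h + ->; rewrite gB.
  by rewrite -gB h // imset_f.
have GE : [seq #|o| | o : {set 'I_n} <- map G (orbits_in B w)] =
    [seq #|o| | o : {set 'I_n} <- orbits_in B w].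
  by rewrite -map_comp; apply: eq_map => o /=; rewrite card_imset //; apply: perm_inj.
rewrite -/(orbits_in B w) -GE; apply: perm_map.
apply: uniq_perm => [||o]; first exact: orbits_in_uniq.
  by rewrite map_inj_uniq ?orbits_in_uniq.
rewrite mem_filter mem_enum; apply/andP/mapP => [[oB /imsetP[y _ oE]]|[o']].
  exists (porbit w (g^-1%g y)); last by rewrite GJ permKV.
  by rewrite mem_filter mem_enum imset_f // -gsub GJ permKV -oE oB.
rewrite mem_filter mem_enum => /andP[sB /imsetP[x _ oE]] ->.
by rewrite gsub sB oE GJ imset_f.
Qed.

End CycleTypes.

(** * Compositions as index sets, and their blocks *)

Section Compositions.

Variable n : nat.
Implicit Types (w u v g : 'S_n) (x y : 'I_n) (B o : {set 'I_n}).
Implicit Types (mu lam : seq nat) (s k p : nat).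

Local Notation pos := (all (fun p => 0 < p)%N).

(** The running offset s allows induction on the composition; offset 0 recovers [par_idx]. *)
Fixpoint idx_from s mu : seq nat :=
  if mu is p :: mu' then iota s p.-1 ++ idx_from (s + p) mu' else [::].

Fixpoint blocks_from s mu : seq {set 'I_n} :=
  if mu is p :: mu' then [set x : 'I_n | (s <= x < s + p)%N] :: blocks_from (s + p) mu'
  else [::].

Lemma par_idxE mu : par_idx mu = idx_from 0 mu.
Proof.
suff key s : flatten [seq iota (s + block_start mu i) (nth 0%N mu i).-1
    | i <- iota 0 (size mu)] = idx_from s mu by rewrite -key.
elim: mu s => //= p mu IHmu s; rewrite -IHmu /block_start /= addn0; congr (_ ++ _).
rewrite -[1%N]addn0 iotaDl -map_comp; congr flatten; apply: eq_map => i /=.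
by rewrite addnA.
Qed.

Lemma blocksE mu : [seq block n mu i | i <- iota 0 (size mu)] = blocks_from 0 mu.
Proof.
suff key s : [seq [set x : 'I_n | (s + block_start mu i <= x
      < s + block_start mu i + nth 0 mu i)%N] | i <- iota 0 (size mu)] =
    blocks_from s mu by rewrite -key.
elim: mu s => //= p mu IHmu s; rewrite -IHmu /block_start /= !addn0; congr (_ :: _).
rewrite -[1%N]addn0 iotaDl -map_comp; apply: eq_map => i /=.
by rewrite addnA.
Qed.

Lemma idx_from_ge s mu k : k \in idx_from s mu -> (s <= k)%N.
Proof.
elim: mu s => //= p mu IHmu s; rewrite mem_cat mem_iota => /orP[/andP[]//|/IHmu].
by move: (p); clear; lia.
Qed.

Lemma idx_from_lt s mu k : pos mu -> k \in idx_from s mu -> (k.+1 < s + sumn mu)%N.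
Proof.
elim: mu s => //= p mu IHmu s /andP[p0 mu0]; rewrite mem_cat mem_iota.
by case/orP=> [/andP[_]|/(IHmu _ mu0)]; move: p0; clear; lia.
Qed.

Lemma idx_from_sorted s mu : sorted ltn (idx_from s mu).
Proof.
rewrite (sorted_pairwise ltn_trans); elim: mu s => //= p mu IHmu s.
rewrite pairwise_cat IHmu -(sorted_pairwise ltn_trans) iota_ltn_sorted !andbT.
apply/allrelP=> a b; rewrite mem_iota => /andP[_ lt] /idx_from_ge.
by move: lt; clear; rewrite /=; lia.
Qed.

(** Splitting a part p into p-1 and 1 removes the last index of its run, and an index is always
    missing between the runs of two parts. *)
Lemma mem_idx_from_minus1 s mu k : pos mu ->
  (k \in idx_from s (comp_minus1 mu)) =
    (k \in idx_from s mu) && (k.+1 \in idx_from s mu).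
Proof.
elim: mu s => //= p mu IHmu s /andP[p0 mu0].
have out j : (j < s + p)%N -> (j \in idx_from (s + p) mu) = false.
  by move=> lt; apply/negP=> /idx_from_ge; rewrite leqNgt lt.
have E : (k \in idx_from s ((if (1 < p)%N then [:: p.-1; 1%N] else [:: p]) ++
      comp_minus1 mu)) =
    ((s <= k)%N && (k.+2 < s + p)%N) || (k \in idx_from (s + p) (comp_minus1 mu)).
  case: ifP => lt1 /=; rewrite !mem_cat !mem_iota.
    rewrite (_ : s + p.-1 + 1 = s + p)%N; last by move: p0; clear; lia.
    by congr (_ || _); move: lt1 p0; clear; lia.
  by congr (_ || _); move: lt1 p0; clear; lia.
rewrite [comp_minus1 _]/= E IHmu // !mem_cat !mem_iota.
case: (ltnP k.+1 (s + p)) => [lt|ge].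
  by rewrite !out //; [rewrite !orbF; move: p0; clear; lia | move: lt; clear; lia].
have -> : ((s <= k)%N && (k.+2 < s + p)%N) = false by move: ge p0; clear; lia.
have -> : ((s <= k)%N && (k < s + p.-1)%N) = false by move: ge p0; clear; lia.
have -> : ((s <= k.+1)%N && (k.+1 < s + p.-1)%N) = false by move: ge p0; clear; lia.
by [].
Qed.

Definition pset mu : {set 'I_n.-1} := [set i : 'I_n.-1 | (i : nat) \in idx_from 0 mu].

Lemma mem_par_simple mu i : (i \in par_simple n mu) = (i \in pset mu).
Proof. by rewrite inE /par_simple mem_pmap_sub par_idxE. Qed.

Lemma par_groupE mu : par_group n mu = parab (pset mu) :> {set 'S_n}.
Proof.
rewrite parab_gen; congr <<_>>%g; apply/setP=> w.
apply/imsetP/imsetP => -[i iJ ->]; exists i => //; by rewrite mem_par_simple in iJ *.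
Qed.

Lemma par_coxeterE mu : par_coxeter n mu = cox (pset mu).
Proof.
congr wprod; apply: (@irr_sorted_eq _ (fun i j : 'I_n.-1 => (i < j)%N)).
- by move=> a b c; apply: ltn_trans.
- by move=> a; apply: ltnn.
- have : sorted ltn [seq val i | i <- par_simple n mu].
    rewrite pmap_filter; last exact: insubK.
    by apply: sorted_filter; [exact: ltn_trans | rewrite par_idxE; exact: idx_from_sorted].
  by rewrite sorted_map.
- exact: enum_sorted.
- by move=> i; rewrite mem_par_simple mem_enum.
Qed.

Lemma pset_minus1 mu : is_composition n mu -> pset (comp_minus1 mu) = prec (pset mu).
Proof.
case/andP=> mu0 /eqP muE; apply/setP=> i; rewrite !inE mem_idx_from_minus1 //.
apply: andb_id2l => iI; apply/idP/exists_inP => [iS|[j]]; last first.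
  by rewrite inE => jI /eqP <-.
have := idx_from_lt mu0 iS; rewrite muE add0n => lt.
have lt' : (i.+1 < n.-1)%N by move: lt; clear; lia.
by exists (Ordinal lt'); rewrite ?inE /=.
Qed.

Lemma hetaE (R : comNzRingType) (xi : R) mu : is_composition n mu ->
  heta xi n mu = eta xi (pset mu).
Proof.
move=> muC; rewrite /heta par_coxeterE par_groupE pset_minus1 //.
have e1 : 1%g = parab set0 :> {set 'S_n}.
  apply/setP=> w; rewrite inE; apply/eqP/idP => [->|/parab0//].
  exact: group1.
rewrite e1 relnormE; apply: eq_bigl => d; rewrite in_setI andb_idr // => _.
by rewrite inE; apply/forall_inP=> i; rewrite inE.
Qed.

Lemma hprojE (R : comNzRingType) (xi : R) mu h : hproj mu h = pj (pset mu) h :> hecke xi n.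
Proof. by apply: eq_bigl => w; rewrite par_groupE. Qed.

Lemma blocks_from_cat s m1 m2 :
  blocks_from s (m1 ++ m2) = blocks_from s m1 ++ blocks_from (s + sumn m1) m2.
Proof. by elim: m1 s => [|p m1 IHm] s /=; rewrite ?addn0 // IHm addnA. Qed.

Lemma blocks_from_bounds s mu B x :
  B \in blocks_from s mu -> x \in B -> (s <= x < s + sumn mu)%N.
Proof.
elim: mu s => //= p mu IHmu s; rewrite inE => /predU1P[->|/IHmu h /h].
  by rewrite inE; move: (x : nat); clear; lia.
by move: (x : nat); clear; lia.
Qed.

Lemma blocks_from_cover s mu x : (s <= x < s + sumn mu)%N ->
  exists2 B, B \in blocks_from s mu & x \in B.
Proof.
elim: mu s => [|p mu IHmu] s /=; first by move: (x : nat); clear; lia.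
move=> xs; case: (ltnP x (s + p)) => [lt|ge].
  by eexists; [apply: mem_head | rewrite inE lt; case/andP: xs => ->].
have [|B BB xB] := IHmu (s + p)%N.
  by move: xs ge; move: (x : nat); clear; lia.
by exists B; rewrite // inE BB orbT.
Qed.

Lemma count_blocks_from s mu x : (s <= x < s + sumn mu)%N ->
  count (fun B : {set 'I_n} => x \in B) (blocks_from s mu) = 1%N.
Proof.
elim: mu s => [|p mu IHmu] s /=; first by move: (x : nat); clear; lia.
move=> xs; rewrite inE; case: (ltnP x (s + p)) => [lt|ge].
  case/andP: xs => -> _; rewrite /= (@eq_in_count _ _ pred0) ?count_pred0 // => B BB.
  by apply/negP=> /(blocks_from_bounds BB); rewrite leqNgt lt.
rewrite andbF IHmu //; move: xs ge; move: (x : nat); clear; lia.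
Qed.

Lemma blocks_from_succ s mu B x y : B \in blocks_from s mu ->
  (x : nat) \in idx_from s mu -> y = x.+1 :> nat -> (x \in B) = (y \in B).
Proof.
elim: mu s => //= p mu IHmu s; rewrite inE mem_cat mem_iota.
case/predU1P=> [->|BB] /orP[xi|xi] yx; rewrite ?inE.
- by move: xi yx; move: (x : nat) (y : nat); clear; lia.
- have := idx_from_ge xi; move: yx; move: (x : nat) (y : nat); clear; lia.
- have out (z : 'I_n) : (z < s + p)%N -> (z \in B) = false.
    by move=> lt; apply/negP=> /(blocks_from_bounds BB); rewrite leqNgt lt.
  by rewrite !out //; move: xi yx; move: (x : nat) (y : nat); clear; lia.
- exact: IHmu BB xi yx.
Qed.

Lemma blocks_from_idx s mu B x y k : B \in blocks_from s mu -> x \in B -> y \in B ->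
  (x <= k < y)%N -> k \in idx_from s mu.
Proof.
elim: mu s => //= p mu IHmu s; rewrite inE mem_cat mem_iota.
case/predU1P=> [->|BB xB yB kxy]; last by rewrite (IHmu _ BB xB yB kxy) orbT.
rewrite !inE => h1 h2 h3; apply/orP; left.
by move: h1 h2 h3; move: (x : nat) (y : nat); clear; lia.
Qed.

Lemma blk_eqI (J : {set 'I_n.-1}) x y : (x <= y)%N ->
  (forall i : 'I_n.-1, (x <= i < y)%N -> i \in J) -> blk J x = blk J y.
Proof.
move=> lexy h; apply/eqP; rewrite eqn_leq blk_mono //.
apply/subset_leq_card/subsetP=> i; rewrite !inE => /andP[iJ ltiy]; rewrite iJ /=.
by rewrite ltnNge; apply: contra iJ => lexi; rewrite h // lexi.
Qed.

Lemma mem_block mu B x y : B \in blocks_from 0 mu -> x \in B ->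
  (y \in B) = (blk (pset mu) y == blk (pset mu) x).
Proof.
move=> BB xB; apply/idP/eqP => [yB|b].
  wlog le : x y xB yB / (x <= y)%N => [th|].
    by case: (leqP x y) => [/th->//|/ltnW/th->].
  apply/esym/blk_eqI => // i ixy; rewrite inE.
  exact: blocks_from_idx BB xB yB ixy.
rewrite (@blk_const _ _ (pset mu) (fun z => z \in B) _ _ _ b) // => i.
by rewrite inE => iJ; apply: blocks_from_succ BB _ _.
Qed.

Lemma block_cover mu x : is_composition n mu ->
  exists2 B, B \in blocks_from 0 mu & x \in B.
Proof. by case/andP=> _ /eqP muE; apply: blocks_from_cover; rewrite muE ltn_ord. Qed.

Lemma block_disjoint mu B B' x : B \in blocks_from 0 mu ->
  B' \in blocks_from 0 mu -> x \in B -> x \in B' -> B = B'.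
Proof.
move=> BB BB' xB xB'; apply/setP=> y.
by rewrite (mem_block y BB xB) (mem_block y BB' xB').
Qed.

Lemma parab_stable mu w : is_composition n mu ->
  (w \in parab (pset mu)) <-> (forall B, B \in blocks_from 0 mu -> stable_on w B).
Proof.
move=> muC; split=> [/parabP wJ B BB x|wB].
  have key z z' : blk (pset mu) z = blk (pset mu) z' -> z \in B -> z' \in B.
    by move=> b zB; rewrite (mem_block z' BB zB) b.
  by apply/idP/idP; apply: key.
apply/parabP=> x; have [B BB xB] := block_cover x muC.
by apply/eqP; rewrite -(mem_block (w x) BB xB) wB.
Qed.

Lemma card_block s p : (s + p <= n)%N -> #|[set x : 'I_n | (s <= x < s + p)%N]| = p.
Proof.
move=> le; rewrite -sum1dep_card -(big_mkord (fun i => (s <= i < s + p)%N) (fun=> 1%N)).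
rewrite -(big_nat_widen 0 (s + p) n (fun i => (s <= i)%N) (fun=> 1%N)) //.
rewrite -(big_nat_widenl s 0 (s + p) xpredT (fun=> 1%N)) // sum_nat_const_nat.
by rewrite muln1 addKn.
Qed.

Lemma card_blocks_from s mu : (s + sumn mu <= n)%N ->
  [seq #|o| | o : {set 'I_n} <- blocks_from s mu] = mu.
Proof.
elim: mu s => //= p mu IHmu s le; rewrite card_block; last by move: le; clear; lia.
by rewrite IHmu // -addnA.
Qed.

Lemma block_nonempty s mu B : pos mu -> (s + sumn mu <= n)%N ->
  B \in blocks_from s mu -> exists x, x \in B.
Proof.
elim: mu s => //= p mu IHmu s /andP[p0 mu0] le; rewrite inE => /predU1P[->|].
  have lt : (s < n)%N by move: le p0; clear; lia.
  by exists (Ordinal lt); rewrite inE /=; move: p0; clear; lia.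
by apply: IHmu; rewrite // -addnA.
Qed.

Lemma blocks_from_uniq s mu : pos mu -> (s + sumn mu <= n)%N -> uniq (blocks_from s mu).
Proof.
elim: mu s => //= p mu IHmu s /andP[p0 mu0] le; rewrite IHmu -?addnA // andbT.
apply/negP=> BB; have p1 : pos [:: p] by rewrite /= p0.
have le1 : (s + sumn [:: p] <= n)%N by move: le; rewrite /=; clear; lia.
have [x xB] := block_nonempty p1 le1 (mem_head _ _).
have := blocks_from_bounds BB xB; move: xB; rewrite inE.
by move: (x : nat); clear; lia.
Qed.

(** The Coxeter element steps from i+1 to i for every i of the index set, so its orbits exhaust the
    blocks that it preserves. *)
Lemma perm_porbits_cox mu : is_composition n mu ->
  perm_eq (enum (porbits (cox (pset mu)))) (blocks_from 0 mu).
Proof.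
move=> muC; have /andP[mu0 /eqP muE] := muC.
have le : (0 + sumn mu <= n)%N by rewrite muE.
have orb x B : B \in blocks_from 0 mu -> x \in B -> porbit (cox (pset mu)) x = B.
  move=> BB xB; have cB := (parab_stable (cox (pset mu)) muC).1 (cox_parab _) B BB.
  apply/setP=> y; apply/idP/idP => [|yB].
    by move=> /porbitP[k ->]; rewrite stable_expg.
  have b : blk (pset mu) y = blk (pset mu) x.
    by apply/eqP; rewrite -(mem_block y BB xB).
  rewrite -eq_porbit_mem; apply/eqP.
  apply: (@blk_const _ _ (pset mu) (porbit (cox (pset mu)))) b => i iJ.
  apply/eqP; rewrite eq_porbit_mem -(cox_hi iJ).
  exact: (mem_porbit _ 1).
apply: uniq_perm; rewrite ?enum_uniq ?blocks_from_uniq // => o.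
rewrite mem_enum; apply/imsetP/idP => [[x _ ->]|oB].
  by have [B BB xB] := block_cover x muC; rewrite (orb x B).
have [x xo] := block_nonempty mu0 le oB.
by exists x; rewrite ?(orb x o).
Qed.

Lemma geq_sortP (t1 t2 : seq nat) : reflect (sort geq t1 = sort geq t2) (perm_eq t1 t2).
Proof.
apply: perm_sortP => [a b|a b c /[swap]|a b]; [exact: leq_total|exact: leq_trans|].
by rewrite andbC => /anti_leq.
Qed.

Lemma sort_geq_id (t : seq nat) : sorted geq t -> sort geq t = t.
Proof. by apply: sorted_sort => a b c /[swap]; apply: leq_trans. Qed.

Lemma cycle_type_cox mu B : is_composition n mu ->
  cycle_type B (cox (pset mu)) =
    sort geq [seq #|o| | o : {set 'I_n} <- [seq o : {set 'I_n} <- blocks_from 0 mu | o \subset B]].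
Proof.
by move=> muC; apply/geq_sortP/perm_map/perm_filter/perm_porbits_cox.
Qed.

(** The lists [pre] and [post] carry the induction: while the block starting at s is examined, the
    other parts give nonempty blocks outside it. *)
Lemma blocks_from_types s lam (th : seq (seq nat)) pre post : all2 is_partition lam th ->
    sumn pre = s -> pos (pre ++ flatten th ++ post) ->
    (sumn (pre ++ flatten th ++ post) <= n)%N ->
  [seq sort geq [seq #|o| | o : {set 'I_n} <- [seq o : {set 'I_n} <-
       blocks_from 0 (pre ++ flatten th ++ post) | o \subset B]]
     | B <- blocks_from s lam] = th.
Proof.
elim: lam th s pre => [|p lam IHlam] [|t th] //= s pre /andP[tP thP] preE.
have /andP[/andP[t0 /eqP tE] ts] := tP.
rewrite -catA => mu0 le; congr (_ :: _); last first.
  have := IHlam th (s + p)%N (pre ++ t) thP; rewrite -!catA; apply=> //.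
  by rewrite sumn_cat preE tE.
have out a m (o : {set 'I_n}) : pos m -> (a + sumn m <= n)%N -> o \in blocks_from a m ->
    (a + sumn m <= s)%N || (s + p <= a)%N ->
    (o \subset [set x : 'I_n | (s <= x < s + p)%N]) = false.
  move=> m0 lem oB dis; apply/negP=> /subsetP sub.
  have [x xo] := block_nonempty m0 lem oB.
  have := blocks_from_bounds oB xo; have := sub x xo; rewrite inE.
  by move: dis; move: (x : nat); clear; lia.
move: mu0 le; rewrite !all_cat !sumn_cat => /and4P[pre0 _ th0 post0] le.
rewrite 2!blocks_from_cat 2!filter_cat preE add0n tE.
rewrite (@eq_in_filter _ _ pred0) => [|o oB]; last first.
  apply: (out 0%N pre) => //; first by move: le; clear; lia.
  by rewrite preE add0n leqnn.
rewrite filter_pred0 /= (@eq_in_filter _ _ predT) => [|o oB]; last first.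
  by apply/subsetP=> x /(blocks_from_bounds oB); rewrite tE inE.
rewrite filter_predT (@eq_in_filter _ _ pred0) => [|o oB]; last first.
  apply: (out (s + p)%N (flatten th ++ post)) => //; first by rewrite all_cat th0.
    by rewrite sumn_cat; move: le; rewrite preE tE; clear; lia.
  by rewrite leqnn orbT.
rewrite filter_pred0 cats0 card_blocks_from ?sort_geq_id // tE.
by move: le; rewrite preE tE; clear; lia.
Qed.

End Compositions.

(** The fibre of conjugation over x^h is the coset C(x) h, so each element of C is reached |C(x)|
    times. *)
Lemma card_conjg_in (gT : finGroupType) (x : gT) (C : {set gT}) :
    (forall w, w \in C -> exists h, (x ^ h = w)%g) ->
  #|[set g | (x ^ g)%g \in C]| = (#|C| * #|'C[x]%g|)%N.
Proof.
move=> Cx; rewrite -sum1dep_card (partition_big (fun g => x ^ g)%g (mem C)) //=.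
rewrite -sum_nat_const; apply: eq_bigr => w wC; have [h xh] := Cx w wC.
rewrite -(card_rcoset 'C[x]%g h) -sum1_card; apply: eq_bigl => g.
rewrite mem_rcoset; have -> : (x ^ g = (x ^ (g * h^-1)) ^ h)%g.
  by rewrite -conjgM mulgKV.
apply/andP/cent1P => [[_ /eqP]|c].
  by rewrite -xh => /conjg_inj e; rewrite /commute [RHS]conjgC e.
suff -> : (x ^ (g * h^-1))%g = x by rewrite xh wC.
by rewrite conjgE -c mulKg.
Qed.

(** * Classes of Young subgroups and the final count *)

Section Types.

Variable n : nat.
Implicit Types (w u v g : 'S_n) (x y : 'I_n) (B o : {set 'I_n}).
Implicit Types (mu lam alpha : seq nat) (th : seq (seq nat)).

Definition types lam w := [seq cycle_type B w | B <- blocks_from n 0 lam].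

Lemma mem_par_class lam th w :
  (w \in par_class n lam th) = (w \in parab (pset n lam)) && (types lam w == th).
Proof. by rewrite in_set par_groupE /types -blocksE -map_comp. Qed.

Lemma cycle_type_partition B w : stable_on w B -> is_partition #|B| (cycle_type B w).
Proof.
move=> wB; rewrite /is_partition sort_sorted ?andbT; last first.
  by move=> a b; apply: leq_total.
apply/andP; split.
  rewrite (perm_all _ (perm_cycle_type B w)) all_map; apply/allP=> o.
  rewrite mem_filter mem_enum => /andP[_ /imsetP[x _ ->]] /=.
  by rewrite lt0n card_porbit_neq0.
rewrite (perm_sumn (perm_cycle_type B w)) sumnE big_map big_filter big_enum_cond /=.
rewrite -[#|B|]sum1_card.
rewrite [X in _ == X](partition_big (porbit w)
  (fun o => (o \in porbits w) && (o \subset B))) => [|x xB] /=; last first.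
  by rewrite imset_f ?stable_porbit.
apply/eqP/eq_bigr => o /andP[/imsetP[z _ ->] sB]; rewrite -sum1_card.
apply: eq_bigl => x; rewrite eq_porbit_mem andb_idl //.
exact: subsetP sB x.
Qed.

Lemma types_multipartition lam w : is_composition n lam -> w \in parab (pset n lam) ->
  is_multipartition lam (types lam w).
Proof.
move=> lamC wL; have wB := (parab_stable w lamC).1 wL.
rewrite /is_multipartition /types; move: wB.
have : (0 + sumn lam <= n)%N by case/andP: lamC => _ /eqP->.
elim: lam {lamC wL} 0%N => //= p lam IHlam s le wB.
rewrite IHlam ?andbT -?addnA // => [|B BB]; last by apply: wB; rewrite inE BB orbT.
have := cycle_type_partition (wB _ (mem_head _ _)); rewrite card_block //.
by move: le; clear; lia.
Qed.

(** Each orbit of w lies in exactly one block, so counting block by block counts it once. *)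
Lemma perm_flatten_types lam w : is_composition n lam -> w \in parab (pset n lam) ->
  perm_eq (flatten (types lam w)) [seq #|o| | o : {set 'I_n} <- enum (porbits w)].
Proof.
move=> lamC wL; have wB := (parab_stable w lamC).1 wL.
apply/seq.permP=> a; rewrite count_flatten -map_comp sumnE big_map count_map.
rewrite -[RHS]sum1_count.
transitivity (\sum_(B <- blocks_from n 0 lam) \sum_(o <- enum (porbits w))
    (a #|o| && (o \subset B) : nat))%N.
  apply: eq_bigr => B _ /=; rewrite (seq.permP (perm_cycle_type B w)) count_map.
  by rewrite count_filter -sum1_count big_mkcond; apply: eq_bigr => o _; case: ifP => /= ->.
rewrite exchange_big /= [RHS]big_mkcond; apply: eq_big_seq => o.
rewrite mem_enum => /imsetP[x _ ->] /=; case: (a _) => /=; last by rewrite big1.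
have xn : (0 <= x < 0 + sumn lam)%N by case/andP: lamC => _ /eqP->; rewrite ltn_ord.
rewrite -(count_blocks_from xn) -sum1_count [RHS]big_mkcond; apply: eq_big_seq => B BB.
by rewrite stable_porbit; [case: (_ \in _) | exact: wB].
Qed.

Lemma perm_cycle_typeT w :
  perm_eq (cycle_type [set: 'I_n] w) [seq #|o| | o : {set 'I_n} <- enum (porbits w)].
Proof.
rewrite (permPl (perm_cycle_type _ _)) /orbits_in (@eq_filter _ _ predT) ?filter_predT //.
by move=> o; rewrite subsetT.
Qed.

Lemma cycle_typeT_cox mu : is_partition n mu ->
  cycle_type [set: 'I_n] (cox (pset n mu)) = mu.
Proof.
move=> /andP[muC muS]; rewrite -[RHS]sort_geq_id //; apply/geq_sortP.
rewrite -/(orbits_in _ _) -(permPl (perm_cycle_type _ _)) (permPl (perm_cycle_typeT _)).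
rewrite -[X in perm_eq _ X](@card_blocks_from n 0 mu); last first.
  by case/andP: muC => _ /eqP->.
exact/perm_map/perm_porbits_cox.
Qed.

Lemma sym_class_conj mu w : is_partition n mu -> w \in sym_class n mu ->
  exists h, (cox (pset n mu) ^ h)%g = w.
Proof.
move=> muP; rewrite inE => /eqP wmu.
have [|||||g _ gw] := @conj_of_cycle_type n [:: setT] (cox (pset n mu)) w.
- by move=> x; exists setT; rewrite ?mem_head ?inE.
- by move=> B B' x; rewrite !inE => /eqP-> /eqP->.
- by move=> B; rewrite inE => /eqP-> x; rewrite !inE.
- by move=> B; rewrite inE => /eqP-> x; rewrite !inE.
- by move=> B; rewrite inE => /eqP->; rewrite cycle_typeT_cox.
by exists g.
Qed.

Lemma card_sym_class mu : is_partition n mu ->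
  (#|sym_class n mu| * #|'C[cox (pset n mu)]%g|)%N = #|[set: 'S_n]|.
Proof.
move=> muP; rewrite -card_conjg_in => [|w]; last exact: sym_class_conj.
congr #|pred_of_set _|; apply/setP=> g; rewrite !inE cycle_type_conj ?cycle_typeT_cox ?eqxx //.
by move=> x; rewrite !inE.
Qed.

Lemma types_conj lam w w' : is_composition n lam -> w \in parab (pset n lam) ->
    w' \in parab (pset n lam) -> types lam w = types lam w' ->
  exists2 g, g \in parab (pset n lam) & (w ^ g)%g = w'.
Proof.
move=> lamC wL w'L /eq_in_map ct.
have [|||||g gB gw] := @conj_of_cycle_type n (blocks_from n 0 lam) w w'.
- by move=> x; apply: block_cover.
- by move=> B B' x; apply: block_disjoint.
- exact/parab_stable.
- exact/parab_stable.
- by [].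
by exists g => //; apply/parab_stable.
Qed.

Lemma flatten_composition lam th : is_composition n lam -> is_multipartition lam th ->
  is_composition n (flatten th).
Proof.
rewrite /is_composition => /andP[_ /eqP <-]; rewrite /is_multipartition.
elim: lam th => [|p lam IHlam] [|t th] //= /andP[/andP[/andP[t0 /eqP tE] _] /IHlam].
by rewrite all_cat sumn_cat t0 tE eqn_add2l.
Qed.

Lemma pset_flatten_sub lam th : is_multipartition lam th ->
  pset n (flatten th) \subset pset n lam.
Proof.
move=> thP; apply/subsetP=> i; rewrite !inE; move: (i : nat) => {i} k.
rewrite /is_multipartition in thP; elim: lam th 0%N thP => [|p lam IHlam] [|t th] s //=.
case/andP=> /andP[/andP[t0 /eqP tE] _] /IHlam IH.
have -> : idx_from s (t ++ flatten th) = idx_from s t ++ idx_from (s + p) (flatten th).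
  rewrite -tE; elim: (t) (s) => [|q t' IHt] s' /=; first by rewrite addn0.
  by rewrite IHt -catA addnA.
rewrite !mem_cat => /orP[kt|/IH->]; last by rewrite orbT.
have := idx_from_ge kt; have := idx_from_lt t0 kt; rewrite tE mem_iota => lt ge.
by apply/orP; left; move: lt ge; clear; lia.
Qed.

Lemma types_cox lam th : is_composition n lam -> is_multipartition lam th ->
  types lam (cox (pset n (flatten th))) = th.
Proof.
move=> lamC thP; have thC := flatten_composition lamC thP.
have /andP[th0 /eqP thE] := thC.
have := @blocks_from_types n 0 lam th [::] [::] thP erefl.
rewrite /= cats0 thE leqnn => /(_ th0 isT) e.
by rewrite -[RHS]e; apply: eq_map => B; apply: cycle_type_cox.
Qed.

Lemma types_conjg lam w u : is_composition n lam -> u \in parab (pset n lam) ->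
  types lam (w ^ u)%g = types lam w.
Proof.
move=> lamC uL; apply/eq_in_map=> B BB; apply: cycle_type_conj.
exact: (parab_stable u lamC).1.
Qed.

Lemma hproj_hb (R : comNzRingType) (xi : R) lam alpha :
    is_composition n lam -> is_partition n alpha ->
  #|par_group n lam|%:R *: hproj lam (hb xi n alpha) =
  #|'C[cox (pset n alpha)]%g|%:R *:
    \sum_(th <- Lambda lam alpha) #|par_class n lam th|%:R *:
      relnorm (par_group n lam) (par_group n (flatten th)) (heta xi n (flatten th)).
Proof.
move=> lamC alP; have /andP[alC alS] := alP.
set L := pset n lam; set c := cox (pset n alpha).
pose N th := relnorm (parab L) (parab (pset n (flatten th)))
               (eta xi (pset n (flatten th))).
have LamP th : th \in Lambda lam alpha -> is_multipartition lam th.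
  by rewrite mem_Lambda => /andP[].
have -> : #|par_group n lam| = #|parab L| by rewrite par_groupE.
rewrite hprojE /hb par_groupE hetaE // (@mackey _ xi n _ L (fun w => N (types lam w))).
- transitivity (\sum_(th <- Lambda lam alpha)
      \sum_(g | (c ^ g)%g \in par_class n lam th) N th).
    under [RHS]eq_bigr do rewrite big_mkcond.
    rewrite exchange_big big_mkcond; apply: eq_bigr => g _ /=.
    case: (boolP ((c ^ g)%g \in parab L)) => cL; last first.
      by rewrite big1_seq // => th _; rewrite mem_par_class (negbTE cL).
    (* Conjugation keeps the overall cycle type alpha, so each conjugate lying in S_lam falls into
       exactly one class of the sum. *)
    have tL : types lam (c ^ g)%g \in Lambda lam alpha.
      rewrite mem_Lambda types_multipartition //=.
      rewrite (permPl (perm_flatten_types lamC cL)).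
      rewrite -(permPl (perm_cycle_typeT _)) cycle_type_conj ?cycle_typeT_cox //.
      by move=> x; rewrite !inE.
    rewrite (bigD1_seq _ tL (Lambda_uniq _ _)) /= mem_par_class cL eqxx.
    rewrite big1 ?addr0 // => th nth; rewrite mem_par_class cL eq_sym.
    by rewrite (negbTE nth).
  rewrite scaler_sumr; apply: eq_big_seq => th thL.
  have thP := LamP th thL; have thC := flatten_composition lamC thP.
  rewrite !par_groupE hetaE // -/(N th) sumr_const scalerA -natrM scaler_nat mulnC.
  (* C_theta consists of conjugates of c, so each of its elements is reached by |C(c)| permutations
     g. *)
  congr (_ *+ _); rewrite -card_conjg_in => [|w]; last first.
    rewrite mem_par_class => /andP[wL /eqP wt]; apply: sym_class_conj => //.
    rewrite inE -[X in _ == X]sort_geq_id //; apply/eqP/geq_sortP.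
    rewrite -/(orbits_in _ _) -(permPl (perm_cycle_type _ _)).
    rewrite (permPl (perm_cycle_typeT w)) -(permPl (perm_flatten_types lamC wL)) wt.
    by move: thL; rewrite mem_Lambda => /andP[].
  by apply: eq_card => g; rewrite inE.
(* The blocks of K need not come in decreasing size inside a block of lam; sorting them gives a
   Coxeter element conjugate in S_lam, and [relnorm_cox_conj] equates the norms. *)
- move=> K sKL; have KL := subsetP (parab_sub sKL) _ (cox_parab K).
  have tP := types_multipartition lamC KL; have sub := pset_flatten_sub tP.
  have [||g gL gE] := types_conj (w := cox (pset n (flatten (types lam (cox K)))))
    (w' := cox K) lamC _ KL.
  - exact: subsetP (parab_sub sub) _ (cox_parab _).
  - exact: types_cox.
  exact: relnorm_cox_conj sub sKL gL gE.
- by move=> w u wL uL; rewrite types_conjg.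
Qed.

End Types.

Theorem theorem9p1 (n : nat) (lam alpha : seq nat)
    (lam_comp : is_composition n lam) (alpha_part : is_partition n alpha) :
  hextQ (hproj lam (hb ('X : {poly int}) n alpha)) =
    (#|[set: 'S_n]|%:R /
       (#|par_group n lam|%:R * #|sym_class n alpha|%:R) : rat)%:P *:
    hextQ (\sum_(th <- Lambda lam alpha)
             #|par_class n lam th|%:R *:
             relnorm (par_group n lam) (par_group n (flatten th))
               (heta ('X : {poly int}) n (flatten th))).
Proof.
have := congr1 (@hextQ n) (hproj_hb ('X : {poly int}) lam_comp alpha_part).
have := card_sym_class alpha_part.
move: (hproj _ _) (\sum_(th <- _) _) #|'C[_]%g| => x y z zE.
rewrite !hextQZ !rmorph_nat => E.
have W0 : (#|par_group n lam|%:R != 0 :> rat) by rewrite Num.Theory.pnatr_eq0 -lt0n cardG_gt0.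
(* An empty class would make |S_n|, its size times the centraliser order, vanish. *)
have C0 : (#|sym_class n alpha|%:R != 0 :> rat).
  rewrite Num.Theory.pnatr_eq0 -lt0n lt0n; apply: contraTneq isT => C0; move: zE.
  rewrite C0 mul0n => /esym/eqP; rewrite cards_eq0 => /eqP/setP/(_ 1%g).
  by rewrite !inE.
have natP k : k%:R = (k%:R : rat)%:P by rewrite rmorph_nat.
have -> : hextQ x = (#|par_group n lam|%:R^-1 : rat)%:P *:
    (#|par_group n lam|%:R *: hextQ x).
  by rewrite scalerA natP -polyCM mulVf // scale1r.
(* Here z is the order of the centraliser; [zE] writes |S_n| as |C_alpha| z, and the class size
   cancels. *)
rewrite E scalerA natP -polyCM -zE natrM invfM; congr (_%:P *: _).
by rewrite [X in _ = X * _]mulrC mulrACA mulfV // mulr1 mulrC.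
Qed.
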